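(* Let $(G,E,\varphi)$ be a self-similar triple and let $R$ be a unital commutative $*$-ring. Then there exists a unique $*$-homomorphism $\pi_{G,E}\colon L_R(G,E)\to A_R(\mathcal{G}_{\text{tight}}(\mathcal{S}_{G,E}))$ such that $$\pi_{G,E}(p_{v,f})=1_{\Theta_{(v,f,f^{-1}\cdot v)}}\quad\text{and}\quad \pi_{G,E}(s_{e,g})=1_{\Theta_{(e,g,g^{-1}\cdot s(e))}}$$ for any $v\in E^0$, $e\in E^1$ and $f,g\in G$. In particular, the generators $p_{v,f}$, $s_{e,g}$ of $L_R(G,E)$ are nonzero.
   Context: A unital commutative $*$-ring $R$ is a commutative ring with $1$ together with an involution $r\mapsto r^*$. A $*$-algebra over $R$ is an (associative, not necessarily unital) $R$-algebra with a map $a\mapsto a^*$ satisfying $(a^* )^*=a$, $(ab)^*=b^*a^*$, $(ra+b)^*=r^*a^*+b^*$. A projection is $p=p^*=p^2$; a partial isometry is $s=ss^*s$. A directed graph $E=(E^0,E^1,r,s)$ has countable vertex set $E^0$, countable edge set $E^1$ and maps $r,s\colon E^1\to E^0$. It is row-finite if $vE^1:=r^{-1}(v)$ is finite for all $v$, and has no sources if $vE^1\neq\emptyset$ for all $v$. An action of a group $G$ on $E$ is a homomorphism from $G$ to the group of bijections of $E^0\sqcup E^1$ that preserve $E^0$ and $E^1$ and commute with $r$ and $s$. A self-similar triple $(G,E,\varphi)$: a countable discrete group $G$ (unit $e_G$), a row-finite graph $E$ with no sources, an action of $G$ on $E$, and a map $\varphi\colon G\times E^1\to G$ with $\varphi(gh,e)=\varphi(g,h\cdot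 e)\varphi(h,e)$ and $\varphi(g,e)\cdot v=g\cdot v$ for all $g,h\in G$, $e\in E^1$, $v\in E^0$. An $E$-family in a $*$-algebra: mutually orthogonal projections $P_v$ ($v\in E^0$) and partial isometries $S_e$ ($e\in E^1$) with $S_e^*S_f=\delta_{e,f}P_{s(e)}$ and $P_v=\sum_{e\in vE^1}S_eS_e^*$. A $(G,E)$-family: elements $P_{v,f}$, $S_{e,g}$ ($v\in E^0$, $e\in E^1$, $f,g\in G$) such that (a) $\{P_{v,e_G}\}\cup\{S_{e,e_G}\}$ is an $E$-family; (b) $(P_{v,f})^*=P_{f^{-1}\cdot v,f^{-1}}$; (c) $P_{v,f}P_{w,h}=\delta_{v,f\cdot w}P_{v,fh}$; (d) $P_{v,f}S_{e,g}=\delta_{v,r(f\cdot e)}S_{f\cdot e,\varphi(f,e)g}$; (e) $S_{e,g}P_{v,f}=\delta_{g\cdot v,s(e)}S_{e,gf}$. $L_R(G,E)$ is the universal $*$-algebra over $R$ generated by a $(G,E)$-family $\{p_{v,f},s_{e,g}\}$. Paths are $\alpha=\alpha_1\cdots\alpha_n$ with $\alpha_i\in E^1$, $s(\alpha_i)=r(\alpha_{i+1})$, $r(\alpha)=r(\alpha_1)$, $s(\alpha)=s(\alpha_n)$; vertices are paths of length $0$; $E^*$ is the set of finite paths and $E^\infty$ the set of infinite paths $e_1e_2\cdots$ ($s(e_i)=r(e_{i+1})$) with the topology having basis $Z(\beta)=\{\beta x: x\in E^\infty, r(x)=s(\beta)\}$, $\beta\in E^*$. The action and cocycle extend to $E^*$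 by $\varphi(g,v)=g$ for $v\in E^0$, $g\cdot(\alpha e)=(g\cdot\alpha)(\varphi(g,\alpha)\cdot e)$, $\varphi(g,\alpha e)=\varphi(\varphi(g,\alpha),e)$, and $G$ acts on $E^\infty$ so that $g\cdot x$ has initial segments $g\cdot(e_1\cdots e_n)$. $\mathcal{S}_{G,E}=\{(\alpha,g,\beta)\in E^*\times G\times E^*: s(\alpha)=g\cdot s(\beta)\}\cup\{0\}$ is an inverse semigroup with zero $0$, $(\alpha,g,\beta)^*=(\beta,g^{-1},\alpha)$ and product $(\alpha,g,\beta)(\gamma,h,\delta)=(\alpha(g\cdot\varepsilon),\varphi(g,\varepsilon)h,\delta)$ if $\gamma=\beta\varepsilon$, $=(\alpha,g\varphi(h^{-1},\varepsilon)^{-1},\delta(h^{-1}\cdot\varepsilon))$ if $\beta=\gamma\varepsilon$, and $0$ otherwise. It acts on $E^\infty$: $s=(\alpha,g,\beta)$ maps $Z(\beta)$ to $Z(\alpha)$ by $s\cdot(\beta x)=\alpha(g\cdot x)$. $\mathcal{G}_{\text{tight}}(\mathcal{S}_{G,E})$ is the groupoid of germs of this action: elements $[s,x]$ with $s=(\alpha,g,\beta)$, $x\in Z(\beta)$, where $[s,x]=[t,y]$ iff $x=y$ and there is $e=(\gamma,e_G,\gamma)$ with $x\in Z(\gamma)$ and $se=te$; source $x$, range $s\cdot x$, product $[s,t\cdot x][t,x]=[st,x]$, inverse $[s,x]^{-1}=[s^*,s\cdot x]$; unit space identified with $E^\infty$. For $s=(\alpha,g,\beta)$ put $\Theta_s=\{[s,x]:x\in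 Z(\beta)\}$; these sets are a basis of compact open bisections for the (possibly non-Hausdorff) topology. For an ample groupoid $\mathcal{G}$ with Hausdorff unit space, the Steinberg algebra is $A_R(\mathcal{G})=\operatorname{span}_R\{1_B: B\text{ a compact open bisection}\}\subseteq R^{\mathcal{G}}$ with product $(fg)(\gamma)=\sum_{\alpha\beta=\gamma}f(\alpha)g(\beta)$ and involution $f^*(\gamma)=f(\gamma^{-1})^*$. *)

(* Defs.v *)
From HB Require Import structures.
From mathcomp Require Import all_boot all_order all_algebra.
From mathcomp Require Import all_classical.
From mathcomp Require Import topology numfun.

Set Implicit Arguments.
Unset Strict Implicit.
Unset Printing Implicit Defensive.

Import GRing.Theory.
Local Open Scope classical_set_scope.
Local Open Scope ring_scope.

Declare Scope starAlg_scope.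

(* Since R is commutative, the anti-multiplicative involution is multiplicative.
   The ring is nontrivial (comNzRingType): 1 <> 0. *)
HB.mixin Record isStarRing R of GRing.ComNzRing R := {
  conjr : R -> R;
  conjrK : involutive conjr;
  conjrD : {morph conjr : a b / a + b};
  conjrM : {morph conjr : a b / a * b}
}.
#[short(type="comStarRingType")]
HB.structure Definition ComStarRing := {R of isStarRing R & GRing.ComNzRing R}.

(* MathComp has no non-unital algebras; the product is [amul], written [**]. *)
HB.mixin Record isStarAlg (R : comStarRingType) A of GRing.Lmodule R A := {
  amul : A -> A -> A;
  star : A -> A;
  amulA : associative amul;
  amulDl : left_distributive amul +%R;
  amulDr : right_distributive amul +%R;
  amulZl : forall (r : R) a b, amul (r *: a) b = r *: amul a b;
  amulZr : forall (r : R) a b, amul a (r *: b) = r *: amul a b;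
  starK : involutive star;
  starM : forall a b, star (amul a b) = amul (star b) (star a);
  starP : forall (r : R) a b, star (r *: a + b) = conjr r *: star a + star b
}.
#[short(type="starAlgType")]
HB.structure Definition StarAlg (R : comStarRingType) :=
  {A of isStarAlg R A & GRing.Lmodule R A}.

Notation "a ** b" := (amul a b) (at level 40, left associativity) : starAlg_scope.
Local Open Scope starAlg_scope.

Definition projection (R : comStarRingType) (A : starAlgType R) (p : A) :=
  p = star p /\ p = p ** p.

Definition partial_isometry (R : comStarRingType) (A : starAlgType R) (s : A) :=
  s = s ** star s ** s.

Record star_hom (R : comStarRingType) (A B : starAlgType R) (h : A -> B) : Prop :=
  StarHom {
    star_hom_linear : forall (r : R) a b, h (r *: a + b) = r *: h a + h b;
    star_hom_mul : {morph h : a b / a ** b};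
    star_hom_star : {morph h : a / star a}
  }.

Section StarAlgTheory.
Context (R : comStarRingType) (A : starAlgType R).
Implicit Types a b : A.

Lemma conjr1 : conjr 1 = 1 :> R.
Proof. by rewrite -[LHS]mulr1 -[X in _ * X]conjrK -conjrM mul1r conjrK. Qed.

Lemma starD : {morph @star R A : a b / a + b}.
Proof. by move=> a b; rewrite -[a]scale1r starP conjr1 !scale1r. Qed.

Lemma star0 : star (0 : A) = 0.
Proof. by apply: (addrI (star (0 : A))); rewrite -starD !addr0. Qed.

Lemma starZ (r : R) a : star (r *: a) = conjr r *: star a.
Proof. by rewrite -[r *: a]addr0 starP star0 addr0. Qed.

End StarAlgTheory.

Section Presentation.
Context (R : comStarRingType) (X : Type).

Inductive sterm : Type :=
| SGen of X
| SZero
| SAdd of sterm & sterm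
| SOpp of sterm
| SScale of R & sterm
| SMul of sterm & sterm
| SStar of sterm.

Context (rel : sterm -> sterm -> Prop).

Inductive scong : sterm -> sterm -> Prop :=
| sc_rel t u : rel t u -> scong t u
| sc_refl t : scong t t
| sc_sym t u : scong t u -> scong u t
| sc_trans t u v : scong t u -> scong u v -> scong t v
| sc_add t t' u u' : scong t t' -> scong u u' -> scong (SAdd t u) (SAdd t' u')
| sc_opp t t' : scong t t' -> scong (SOpp t) (SOpp t')
| sc_scale r t t' : scong t t' -> scong (SScale r t) (SScale r t')
| sc_mul t t' u u' : scong t t' -> scong u u' -> scong (SMul t u) (SMul t' u')
| sc_star t t' : scong t t' -> scong (SStar t) (SStar t')
| sc_addA t u v : scong (SAdd t (SAdd u v)) (SAdd (SAdd t u) v)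
| sc_addC t u : scong (SAdd t u) (SAdd u t)
| sc_add0 t : scong (SAdd SZero t) t
| sc_addN t : scong (SAdd (SOpp t) t) SZero
| sc_scaleA r r' t : scong (SScale r (SScale r' t)) (SScale (r * r') t)
| sc_scale1 t : scong (SScale 1 t) t
| sc_scaleDr r t u : scong (SScale r (SAdd t u)) (SAdd (SScale r t) (SScale r u))
| sc_scaleDl r r' t : scong (SScale (r + r') t) (SAdd (SScale r t) (SScale r' t))
| sc_mulA t u v : scong (SMul t (SMul u v)) (SMul (SMul t u) v)
| sc_mulDl t u v : scong (SMul (SAdd t u) v) (SAdd (SMul t v) (SMul u v))
| sc_mulDr t u v : scong (SMul t (SAdd u v)) (SAdd (SMul t u) (SMul t v))
| sc_mulZl r t u : scong (SMul (SScale r t) u) (SScale r (SMul t u))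
| sc_mulZr r t u : scong (SMul t (SScale r u)) (SScale r (SMul t u))
| sc_starK t : scong (SStar (SStar t)) t
| sc_starM t u : scong (SStar (SMul t u)) (SMul (SStar u) (SStar t))
| sc_starP r t u : scong (SStar (SAdd (SScale r t) u))
                         (SAdd (SScale (conjr r) (SStar t)) (SStar u)).

HB.instance Definition _ := gen_eqMixin sterm.
HB.instance Definition _ := gen_choiceMixin sterm.

Record presented := Presented {
  pclass : set sterm;
  pclassP : exists t, pclass = scong t
}.
HB.instance Definition _ := gen_eqMixin presented.
HB.instance Definition _ := gen_choiceMixin presented.

Definition pcl (t : sterm) : presented := Presented (ex_intro _ t erefl).
Definition prep (a : presented) : sterm := projT1 (cid (pclassP a)).

Lemma pclP t u : (pcl t = pcl u) <-> scong t u.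
Proof.
split=> [[->]|tu]; first exact: sc_refl.
have e : scong t = scong u.
  apply/funext => v; apply/propext; split; last exact: sc_trans.
  exact: sc_trans (sc_sym tu).
rewrite /pcl; move: (ex_intro _ t _) (ex_intro _ u _); rewrite e => h h'.
by rewrite (Prop_irrelevance h h').
Qed.

Lemma prepK a : pcl (prep a) = a.
Proof.
rewrite /prep; case: cid => t /= aE; case: a aE => P p /= PE; subst P.
by rewrite /pcl; congr Presented; exact: Prop_irrelevance.
Qed.

Lemma pcl_rep t : scong (prep (pcl t)) t.
Proof. by apply/pclP; rewrite prepK. Qed.

Let padd (a b : presented) := pcl (SAdd (prep a) (prep b)).
Let popp (a : presented) := pcl (SOpp (prep a)).
Let pscale (r : R) (a : presented) := pcl (SScale r (prep a)).
Let pmul (a b : presented) := pcl (SMul (prep a) (prep b)).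
Let pstar (a : presented) := pcl (SStar (prep a)).

Let paddE t u : padd (pcl t) (pcl u) = pcl (SAdd t u).
Proof. by apply/pclP; apply: sc_add; exact: pcl_rep. Qed.
Let poppE t : popp (pcl t) = pcl (SOpp t).
Proof. by apply/pclP; apply: sc_opp; exact: pcl_rep. Qed.
Let pscaleE r t : pscale r (pcl t) = pcl (SScale r t).
Proof. by apply/pclP; apply: sc_scale; exact: pcl_rep. Qed.
Let pmulE t u : pmul (pcl t) (pcl u) = pcl (SMul t u).
Proof. by apply/pclP; apply: sc_mul; exact: pcl_rep. Qed.
Let pstarE t : pstar (pcl t) = pcl (SStar t).
Proof. by apply/pclP; apply: sc_star; exact: pcl_rep. Qed.

Let paddA : associative padd.
Proof.
move=> a b c; rewrite -[a]prepK -[b]prepK -[c]prepK !paddE.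
by apply/pclP; exact: sc_addA.
Qed.
Let paddC : commutative padd.
Proof.
by move=> a b; rewrite -[a]prepK -[b]prepK !paddE; apply/pclP; exact: sc_addC.
Qed.
Let padd0 : left_id (pcl SZero) padd.
Proof. by move=> a; rewrite -[a]prepK paddE; apply/pclP; exact: sc_add0. Qed.
Let paddN : left_inverse (pcl SZero) popp padd.
Proof. by move=> a; rewrite -[a]prepK poppE paddE; apply/pclP; exact: sc_addN. Qed.

HB.instance Definition _ := GRing.isZmodule.Build presented paddA paddC padd0 paddN.

Lemma pclD t u : pcl (SAdd t u) = pcl t + pcl u.
Proof. exact/esym/paddE. Qed.
Lemma pclN t : pcl (SOpp t) = - pcl t.
Proof. exact/esym/poppE. Qed.

Let pscaleA r r' a : pscale r (pscale r' a) = pscale (r * r') a.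
Proof. by rewrite -[a]prepK !pscaleE; apply/pclP; exact: sc_scaleA. Qed.
Let pscale1 : left_id 1 pscale.
Proof. by move=> a; rewrite -[a]prepK !pscaleE; apply/pclP; exact: sc_scale1. Qed.
Let pscaleDr : right_distributive pscale +%R.
Proof.
move=> r a b; rewrite -[a]prepK -[b]prepK -pclD !pscaleE -pclD.
by apply/pclP; exact: sc_scaleDr.
Qed.
Let pscaleDl a : {morph pscale^~ a : r r' / r + r'}.
Proof.
move=> r r'; rewrite -[a]prepK !pscaleE -pclD.
by apply/pclP; exact: sc_scaleDl.
Qed.

HB.instance Definition _ :=
  GRing.Zmodule_isLmodule.Build R presented pscaleA pscale1 pscaleDr pscaleDl.

Lemma pclZ r t : pcl (SScale r t) = r *: pcl t.
Proof. exact/esym/pscaleE. Qed.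

Let pmulA : associative pmul.
Proof.
move=> a b c; rewrite -[a]prepK -[b]prepK -[c]prepK !pmulE.
by apply/pclP; exact: sc_mulA.
Qed.
Let pmulDl : left_distributive pmul +%R.
Proof.
move=> a b c; rewrite -[a]prepK -[b]prepK -[c]prepK -pclD !pmulE -pclD.
by apply/pclP; exact: sc_mulDl.
Qed.
Let pmulDr : right_distributive pmul +%R.
Proof.
move=> a b c; rewrite -[a]prepK -[b]prepK -[c]prepK -pclD !pmulE -pclD.
by apply/pclP; exact: sc_mulDr.
Qed.
Let pmulZl (r : R) (a b : presented) : pmul (r *: a) b = r *: pmul a b.
Proof.
rewrite -[a]prepK -[b]prepK -pclZ !pmulE -pclZ.
by apply/pclP; exact: sc_mulZl.
Qed.
Let pmulZr (r : R) (a b : presented) : pmul a (r *: b) = r *: pmul a b.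
Proof.
rewrite -[a]prepK -[b]prepK -pclZ !pmulE -pclZ.
by apply/pclP; exact: sc_mulZr.
Qed.
Let pstarK : involutive pstar.
Proof. by move=> a; rewrite -[a]prepK !pstarE; apply/pclP; exact: sc_starK. Qed.
Let pstarM a b : pstar (pmul a b) = pmul (pstar b) (pstar a).
Proof.
rewrite -[a]prepK -[b]prepK [in LHS]pmulE !pstarE pmulE.
by apply/pclP; exact: sc_starM.
Qed.
Let pstarP (r : R) (a b : presented) :
  pstar (r *: a + b) = conjr r *: pstar a + pstar b.
Proof.
rewrite -[a]prepK -[b]prepK -pclZ -pclD !pstarE -pclZ -pclD.
by apply/pclP; exact: sc_starP.
Qed.

HB.instance Definition _ := isStarAlg.Build R presented
  pmulA pmulDl pmulDr pmulZl pmulZr pstarK pstarM pstarP.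

Lemma pcl0 : pcl SZero = 0. Proof. by []. Qed.
Lemma pclM t u : pcl (SMul t u) = pcl t ** pcl u.
Proof. exact/esym/pmulE. Qed.
Lemma pcl_star t : pcl (SStar t) = star (pcl t).
Proof. exact/esym/pstarE. Qed.

Fixpoint seval (B : starAlgType R) (h : X -> B) (t : sterm) : B :=
  match t with
  | SGen x => h x
  | SZero => 0
  | SAdd t u => seval h t + seval h u
  | SOpp t => - seval h t
  | SScale r t => r *: seval h t
  | SMul t u => seval h t ** seval h u
  | SStar t => star (seval h t)
  end.

Lemma seval_scong (B : starAlgType R) (h : X -> B) :
  (forall t u, rel t u -> seval h t = seval h u) ->
  forall t u, scong t u -> seval h t = seval h u.
Proof.
move=> hrel t u; elim=> //=; try by move=> *; congruence.
- by move=> *; rewrite addrA.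
- by move=> *; rewrite addrC.
- by move=> *; rewrite add0r.
- by move=> *; rewrite addNr.
- by move=> *; rewrite scalerA.
- by move=> *; rewrite scale1r.
- by move=> *; rewrite scalerDr.
- by move=> *; rewrite scalerDl.
- by move=> *; rewrite amulA.
- by move=> *; rewrite amulDl.
- by move=> *; rewrite amulDr.
- by move=> *; rewrite amulZl.
- by move=> *; rewrite amulZr.
- by move=> *; rewrite starK.
- by move=> *; rewrite starM.
- by move=> *; rewrite starP.
Qed.

Theorem presented_universal (B : starAlgType R) (h : X -> B) :
  (forall t u, rel t u -> seval h t = seval h u) ->
  exists! k : presented -> B, star_hom k /\ forall x, k (pcl (SGen x)) = h x.
Proof.
move=> hrel; pose k (a : presented) := seval h (prep a).
have kE t : k (pcl t) = seval h t by apply: seval_scong => //; exact: pcl_rep.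
exists k; split.
  split=> [|x]; last by rewrite kE.
  split=> [r a b|a b|a].
  - by rewrite -[a]prepK -[b]prepK -pclZ -pclD !kE.
  - by rewrite -[a]prepK -[b]prepK -pclM !kE.
  - by rewrite -[a]prepK -pcl_star !kE.
move=> k' [[lin mul st] gen]; apply/funext => a; rewrite -[a]prepK kE.
have k0 : k' 0 = 0.
  have := lin 1 0 0; rewrite !scale1r addr0 => e.
  by apply: (addrI (k' 0)); rewrite addr0 -e.
have kZ r x : k' (r *: x) = r *: k' x by rewrite -[r *: x]addr0 lin k0 addr0.
have kD x y : k' (x + y) = k' x + k' y by rewrite -[x]scale1r lin !scale1r.
elim: (prep a) => //=.
- by move=> t IHt u IHu; rewrite pclD kD IHt IHu.
- by move=> t IHt; rewrite pclN -[in RHS]scaleN1r kZ scaleN1r IHt.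
- by move=> r t IHt; rewrite pclZ kZ IHt.
- by move=> t IHt u IHu; rewrite pclM mul IHt IHu.
- by move=> t IHt; rewrite pcl_star st IHt.
Qed.

End Presentation.

#[short(type="countGroupType")]
HB.structure Definition CountGroup := {G of Group G & Countable G}.

Record graph := Graph {
  vert : countType;
  edge : countType;
  rg : edge -> vert;
  sr : edge -> vert
}.

Definition row_finite (E : graph) :=
  forall v : vert E, finite_set [set e : edge E | rg e = v].

Definition no_sources (E : graph) := forall v : vert E, exists e : edge E, rg e = v.

(* Since a bijection in the acting group preserves vertices and edges, an
   action on the disjoint union is a pair of actions. *)
Record graph_action (G : countGroupType) (E : graph) := GraphAction {
  actv : G -> vert E -> vert E;
  acte : G -> edge E -> edge E;
  actv1 : forall v, actv 1%g v = v;
  actvM : forall g h v, actv (g * h)%g v = actv g (actv h v);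
  acte1 : forall e, acte 1%g e = e;
  acteM : forall g h e, acte (g * h)%g e = acte g (acte h e);
  act_rg : forall g e, rg (acte g e) = actv g (rg e);
  act_sr : forall g e, sr (acte g e) = actv g (sr e)
}.

Record selfSimilarTriple := SelfSimilarTriple {
  ssG : countGroupType;
  ssE : graph;
  ss_row_finite : row_finite ssE;
  ss_no_sources : no_sources ssE;
  ss_act : graph_action ssG ssE;
  phi : ssG -> edge ssE -> ssG;
  phiM : forall g h e, phi (g * h)%g e = (phi g (acte ss_act h e) * phi h e)%g;
  phi_actv : forall g e v, actv ss_act (phi g e) v = actv ss_act g v
}.

Definition is_E_family (R : comStarRingType) (E : graph) (A : starAlgType R)
    (P : vert E -> A) (S : edge E -> A) : Prop :=
  [/\ forall v, projection (P v),
      forall v w, v != w -> P v ** P w = 0,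
      forall e, partial_isometry (S e),
      forall e f, star (S e) ** S f = if e == f then P (sr e) else 0
    & forall v, P v = \sum_(e \in [set e | rg e = v]) (S e ** star (S e))].

Section SelfSimilar.
Context (T : selfSimilarTriple).
Notation G := (ssG T).
Notation E := (ssE T).
Notation V := (vert E).
Notation Ed := (edge E).
Local Notation "g *v v" := (actv (ss_act T) g v) (at level 35, right associativity).
Local Notation "g *e e" := (acte (ss_act T) g e) (at level 35, right associativity).
Implicit Types (g h : G) (v w : V) (e : Ed).

Definition is_GE_family (R : comStarRingType) (A : starAlgType R)
    (P : V -> G -> A) (S : Ed -> G -> A) : Prop :=
  [/\ is_E_family (fun v => P v 1%g) (fun e => S e 1%g),
      forall v f, star (P v f) = P (f^-1%g *v v) f^-1%g,
      forall v f w h, P v f ** P w h = if v == f *v w then P v (f * h)%g else 0,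
      forall v f e g, P v f ** S e g =
        if v == rg (f *e e) then S (f *e e) (phi f e * g)%g else 0
    & forall e g v f, S e g ** P v f =
        if g *v v == sr e then S e (g * f)%g else 0].

Inductive GEgen : Type := GenP of V & G | GenS of Ed & G.

Section Leavitt.
Context (R : comStarRingType).

Let tP v g : sterm R GEgen := SGen R (GenP v g).
Let tS e g : sterm R GEgen := SGen R (GenS e g).
Let tsum (l : seq Ed) : sterm R GEgen :=
  foldr (fun e t => SAdd (SMul (tS e 1%g) (SStar (tS e 1%g))) t) (SZero R GEgen) l.

Inductive GErel : sterm R GEgen -> sterm R GEgen -> Prop :=
| ge_proj_star v : GErel (tP v 1%g) (SStar (tP v 1%g))
| ge_proj_idem v : GErel (tP v 1%g) (SMul (tP v 1%g) (tP v 1%g))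
| ge_orth v w : v != w -> GErel (SMul (tP v 1%g) (tP w 1%g)) (SZero R GEgen)
| ge_pisom e : GErel (tS e 1%g) (SMul (SMul (tS e 1%g) (SStar (tS e 1%g))) (tS e 1%g))
| ge_SS e f : GErel (SMul (SStar (tS e 1%g)) (tS f 1%g))
                    (if e == f then tP (sr e) 1%g else SZero R GEgen)
| ge_sum v (l : seq Ed) : uniq l -> (forall e, (e \in l) = (rg e == v)) ->
    GErel (tP v 1%g) (tsum l)
| ge_starP v f : GErel (SStar (tP v f)) (tP (f^-1%g *v v) f^-1%g)
| ge_PP v f w h : GErel (SMul (tP v f) (tP w h))
                        (if v == f *v w then tP v (f * h)%g else SZero R GEgen)
| ge_PS v f e g : GErel (SMul (tP v f) (tS e g))
    (if v == rg (f *e e) then tS (f *e e) (phi f e * g)%g else SZero R GEgen)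
| ge_SP e g v f : GErel (SMul (tS e g) (tP v f))
    (if g *v v == sr e then tS e (g * f)%g else SZero R GEgen).

(* L_R(G,E) as the star algebra presented by the (G,E)-family relations; see
   [LGE_family] and [LGE_universal] for the universal property. *)
Definition LGE : starAlgType R := presented GErel.
Definition Lp v g : LGE := pcl GErel (tP v g).
Definition Ls e g : LGE := pcl GErel (tS e g).

Lemma edges_into v :
  exists2 l : seq Ed, uniq l & forall e, (e \in l) = (rg e == v).
Proof.
have /finite_seqP[l lE] := @ss_row_finite T v.
exists (undup l); first exact: undup_uniq.
move=> e; rewrite mem_undup; apply/idP/eqP => [el|ev].
  by have : [set` l] e by []; rewrite -lE.
by have : [set e | rg e = v] e by []; rewrite lE.
Qed.

Lemma edges_sum (A : zmodType) v (l : seq Ed) (F : Ed -> A) :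
  uniq l -> (forall e, (e \in l) = (rg e == v)) ->
  \sum_(e \in [set e | rg e = v]) F e = \sum_(e <- l) F e.
Proof.
move=> ul lP; have -> : [set e | rg e = v] = [set` l].
  by apply/seteqP; split=> e /=; rewrite lP => /eqP.
exact/esym/fsbig_seq.
Qed.

Definition GEmap (A : starAlgType R) (P : V -> G -> A) (S : Ed -> G -> A)
    (x : GEgen) : A :=
  match x with GenP v g => P v g | GenS e g => S e g end.

Lemma GE_family_rel (A : starAlgType R) (P : V -> G -> A) (S : Ed -> G -> A) :
  is_GE_family P S <->
  forall t u, GErel t u -> seval (GEmap P S) t = seval (GEmap P S) u.
Proof.
set h := GEmap P S.
have tsumE l : seval h (tsum l) = \sum_(e <- l) (S e 1%g ** star (S e 1%g)).
  by elim: l => [|e l IHl]; rewrite ?big_nil // big_cons -IHl.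
split=> [[[proj orth pisom SS sumE] sP PP PS SP] t u|rel] /=.
  case=> //=.
  - by move=> v; have [] := proj v.
  - by move=> v; have [] := proj v.
  - by move=> e f; rewrite SS; case: ifP.
  - by move=> v l ul lP; rewrite -/h tsumE sumE (edges_sum _ ul lP).
  - by move=> v f w k; rewrite PP; case: ifP.
  - by move=> v f e g; rewrite PS; case: ifP.
  - by move=> e g v f; rewrite SP; case: ifP.
split; first split.
- by move=> v; split; [exact: (rel _ _ (ge_proj_star v))|exact: (rel _ _ (ge_proj_idem v))].
- by move=> v w vw; exact: (rel _ _ (ge_orth vw)).
- by move=> e; exact: (rel _ _ (ge_pisom e)).
- by move=> e f; rewrite [LHS](rel _ _ (ge_SS e f)); case: ifP.
- move=> v; have [l ul lP] := edges_into v.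
  by rewrite (edges_sum _ ul lP) -tsumE [LHS](rel _ _ (ge_sum ul lP)).
- by move=> v f; exact: (rel _ _ (ge_starP v f)).
- by move=> v f w k; rewrite [LHS](rel _ _ (ge_PP v f w k)); case: ifP.
- by move=> v f e g; rewrite [LHS](rel _ _ (ge_PS v f e g)); case: ifP.
- by move=> e g v f; rewrite [LHS](rel _ _ (ge_SP e g v f)); case: ifP.
Qed.

Lemma LGE_family : is_GE_family Lp Ls.
Proof.
apply/GE_family_rel => t u tu.
have hE s : seval (GEmap Lp Ls) s = pcl GErel s.
  elim: s => //=; first by case.
  - by move=> s -> s' ->; rewrite pclD.
  - by move=> s ->; rewrite pclN.
  - by move=> r s ->; rewrite pclZ.
  - by move=> s -> s' ->; rewrite pclM.
  - by move=> s ->; rewrite pcl_star.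
by rewrite !hE; apply/pclP; exact: sc_rel.
Qed.

Theorem LGE_universal (B : starAlgType R) (P : V -> G -> B) (S : Ed -> G -> B) :
  is_GE_family P S ->
  exists! k : LGE -> B, [/\ star_hom k, forall v f, k (Lp v f) = P v f
                          & forall e g, k (Ls e g) = S e g].
Proof.
move=> /GE_family_rel fam.
have [k [[khom kgen] kuniq]] := presented_universal fam.
exists k; split; first by split=> // [v f|e g]; [exact: (kgen (GenP v f))|exact: (kgen (GenS e g))].
by move=> k' [hom kP kS]; apply: kuniq; split=> // -[].
Qed.

End Leavitt.

End SelfSimilar.

Section Paths.
Context (E : graph).
Implicit Types (v : vert E) (e : edge E) (p q : seq (edge E)).

Fixpoint is_path v p : bool :=
  if p is e :: p' then (rg e == v) && is_path (sr e) p' else true.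

Lemma mkseqSc (X : Type) (f : nat -> X) n : mkseq f n.+1 = mkseq f n ++ [:: f n].
Proof. by rewrite mkseqS cats1. Qed.

Definition plast v p : vert E := last v (map (@sr E) p).

(* A path is stored with its range, so that vertices are the paths of length 0. *)
Record fpath := FPath {
  fpath_val : vert E * seq (edge E);
  fpath_valP : is_path fpath_val.1 fpath_val.2
}.
HB.instance Definition _ := [isSub for fpath_val].
HB.instance Definition _ := [Countable of fpath by <:].

Implicit Types a b c : fpath.

Definition prg a : vert E := (val a).1.
Definition pedges a : seq (edge E) := (val a).2.
Definition psr a : vert E := plast (prg a) (pedges a).
Definition plen a : nat := size (pedges a).

Lemma plast_cat v p q : plast v (p ++ q) = plast (plast v p) q.
Proof. by rewrite /plast map_cat last_cat. Qed.

Lemma is_path_cat v p q : is_path v (p ++ q) = is_path v p && is_path (plast v p) q.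
Proof. by elim: p v => //= e p IHp v; rewrite IHp andbA. Qed.

Lemma fpathP a : is_path (prg a) (pedges a). Proof. exact: (valP a). Qed.

Lemma fpath_inj a b : prg a = prg b -> pedges a = pedges b -> a = b.
Proof.
by move=> ab1 ab2; apply: val_inj; rewrite [val a]surjective_pairing
  [val b]surjective_pairing; congr pair.
Qed.

Definition vpath v : fpath := @FPath (v, [::]) isT.

Lemma epath_subproof e : is_path (rg e, [:: e]).1 (rg e, [:: e]).2.
Proof. by rewrite /= eqxx. Qed.
Definition epath e : fpath := @FPath _ (epath_subproof e).

(* The concatenation ab; a dummy value unless s(a) = r(b). *)
Definition fcat a b : fpath := insubd a (prg a, pedges a ++ pedges b).

Definition fprefix a b : bool := (prg a == prg b) && prefix (pedges a) (pedges b).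

(* The path left after removing the first n edges. *)
Lemma fdrop_subproof n a :
  let: b := (plast (prg a) (take n (pedges a)), drop n (pedges a)) in is_path b.1 b.2.
Proof. by have := fpathP a; rewrite -{1}(cat_take_drop n (pedges a)) is_path_cat => /andP[]. Qed.
Definition fdrop n a : fpath := @FPath _ (fdrop_subproof n a).

Lemma prg_fdrop n a : prg (fdrop n a) = plast (prg a) (take n (pedges a)).
Proof. by []. Qed.

Lemma pedges_fdrop n a : pedges (fdrop n a) = drop n (pedges a).
Proof. by []. Qed.

Lemma prg_fcat a b : psr a = prg b -> prg (fcat a b) = prg a.
Proof.
by move=> ab; rewrite /prg /fcat insubdK //= /in_mem /= is_path_cat fpathP -/(psr a) ab fpathP.
Qed.

Lemma pedges_fcat a b : psr a = prg b -> pedges (fcat a b) = pedges a ++ pedges b.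
Proof.
by move=> ab; rewrite {1}/pedges /fcat insubdK //= /in_mem /= is_path_cat fpathP -/(psr a) ab fpathP.
Qed.

Lemma psr_fcat a b : psr a = prg b -> psr (fcat a b) = psr b.
Proof.
by move=> ab; rewrite /psr prg_fcat // pedges_fcat // plast_cat -/(psr a) ab.
Qed.

Lemma fcat_fdrop a b : fprefix a b ->
  psr a = prg (fdrop (plen a) b) /\ b = fcat a (fdrop (plen a) b).
Proof.
case/andP=> /eqP ab /prefixP[q bq].
have ad : psr a = prg (fdrop (plen a) b).
  by rewrite prg_fdrop bq take_size_cat // /psr ab.
split=> //; apply: fpath_inj; rewrite ?prg_fcat ?pedges_fcat //.
by rewrite pedges_fdrop bq drop_size_cat.
Qed.

Lemma fprefixP a b : reflect (exists2 c, psr a = prg c & b = fcat a c) (fprefix a b).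
Proof.
apply: (iffP idP) => [/fcat_fdrop[]|[c ac ->]]; first by exists (fdrop (plen a) b).
by rewrite /fprefix prg_fcat // eqxx pedges_fcat //; apply/prefixP; exists (pedges c).
Qed.

Record ipath := IPath {
  ipfun :> nat -> edge E;
  ipathP : forall n, sr (ipfun n) = rg (ipfun n.+1)
}.
HB.instance Definition _ := gen_eqMixin ipath.
HB.instance Definition _ := gen_choiceMixin ipath.

Implicit Types x y : ipath.

Lemma ipath_inj x y : x =1 y -> x = y.
Proof.
case: x y => [x xP] [y yP] /= /funext xy; subst y.
by congr IPath; exact: Prop_irrelevance.
Qed.

Definition irg x : vert E := rg (x 0).

Definition ishift k x : ipath :=
  @IPath (fun n => x (k + n)%N) (fun n => etrans (ipathP x _) (congr1 _ (congr1 x (esym (addnS k n))))).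

Definition icat_fun p (x : nat -> edge E) (n : nat) : edge E := nth (x (n - size p)%N) p n.

Lemma icat_subproof a x : irg x = psr a ->
  forall n, sr (icat_fun (pedges a) x n) = rg (icat_fun (pedges a) x n.+1).
Proof.
rewrite /psr => + n; move: (fpathP a); rewrite /icat_fun.
elim: (pedges a) (prg a) n => [|e p IHp] v n /=.
  by move=> _ _; rewrite !nth_nil !subn0; exact: ipathP.
case/andP=> _ pP xp; case: n => [|n] /=; last by rewrite !subSS (IHp (sr e)).
case: p pP xp {IHp} => [|e' p] /=; first by rewrite subnn.
by case/andP => /eqP.
Qed.

(* The concatenation ax; a dummy value unless s(a) = r(x). *)
Definition icat a x : ipath :=
  if pselect (irg x = psr a) is left ax then IPath (icat_subproof ax) else x.

Lemma icatE a x : irg x = psr a -> icat a x =1 icat_fun (pedges a) x.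
Proof. by rewrite /icat; case: pselect. Qed.

(* Z(a) = {ax : r(x) = s(a)} *)
Definition cyl a : set ipath := [set icat a x | x in [set x | irg x = psr a]].

Lemma is_path_mkseq x n : is_path (irg x) (mkseq x n).
Proof.
elim: n => // n IHn; rewrite mkseqSc is_path_cat IHn /= andbT.
by case: n {IHn} => [|n] //; rewrite mkseqSc plast_cat /plast /= ipathP.
Qed.

Lemma plast_mkseq x n : plast (irg x) (mkseq x n) = rg (x n).
Proof.
by case: n => // n; rewrite mkseqSc plast_cat; exact: ipathP.
Qed.

Lemma irg_ishift k x : irg (ishift k x) = rg (x k).
Proof. by rewrite /irg /= addn0. Qed.

Lemma cylP a y : cyl a y <-> irg y = prg a /\ mkseq y (plen a) = pedges a.
Proof.
split=> [[x /= xa <-]|[ya yE]].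
  have yE : mkseq (icat a x) (plen a) = pedges a.
    apply: (@eq_from_nth _ (x 0)); rewrite ?size_mkseq // => i ia.
    by rewrite nth_mkseq // icatE // /icat_fun; apply: set_nth_default.
  split=> //; rewrite /irg icatE // /icat_fun sub0n; move: (fpathP a) xa.
  rewrite /psr; case: (pedges a) => [|e p] /=; last by case/andP=> /eqP.
  by move=> _; rewrite -/(irg x).
have sa : irg (ishift (plen a) y) = psr a.
  by rewrite irg_ishift /psr -ya -yE plast_mkseq.
exists (ishift (plen a) y) => //; apply: ipath_inj => n.
rewrite icatE // /icat_fun /=; case: (ltnP n (plen a)) => na.
  by rewrite -yE nth_mkseq.
by rewrite nth_default // subnKC.
Qed.

Lemma ishift_icat a x : irg x = psr a -> ishift (plen a) (icat a x) = x.
Proof.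
move=> xa; apply: ipath_inj => n; rewrite /= icatE // /icat_fun.
by rewrite nth_default ?leq_addr // addKn.
Qed.

Lemma cyl_shift a y : cyl a y ->
  irg (ishift (plen a) y) = psr a /\ icat a (ishift (plen a) y) = y.
Proof. by move=> [x /= xa <-]; rewrite ishift_icat. Qed.

Definition itake n x : fpath := @FPath (irg x, mkseq x n) (is_path_mkseq x n).

Lemma cyl_itake n x : cyl (itake n x) x.
Proof. by apply/cylP; rewrite /plen /= size_mkseq. Qed.

End Paths.

Section TightGroupoid.
Context (T : selfSimilarTriple).
Notation G := (ssG T).
Notation E := (ssE T).
Notation V := (vert E).
Notation Ed := (edge E).
Local Notation "g *v v" := (actv (ss_act T) g v) (at level 35, right associativity).
Local Notation "g *e e" := (acte (ss_act T) g e) (at level 35, right associativity).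
Implicit Types (g h : G) (v w : V) (e : Ed) (p q : seq Ed) (a b c : fpath E)
  (x y : ipath E).

Definition coc g p : G := foldl (@phi T) g p.

Fixpoint eact g p : seq Ed :=
  if p is e :: p' then g *e e :: eact (phi g e) p' else [::].

Lemma size_eact g p : size (eact g p) = size p.
Proof. by elim: p g => //= e p IHp g; rewrite IHp. Qed.

Lemma coc_cat g p q : coc g (p ++ q) = coc (coc g p) q.
Proof. exact: foldl_cat. Qed.

Lemma eact_cat g p q : eact g (p ++ q) = eact g p ++ eact (coc g p) q.
Proof. by elim: p g => //= e p IHp g; rewrite IHp. Qed.

Lemma coc_actv g p v : coc g p *v v = g *v v.
Proof. by elim: p g => //= e p IHp g; rewrite IHp phi_actv. Qed.

Lemma phi1 e : phi 1%g e = 1%g :> G.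
Proof.
have := @phiM T 1%g 1%g e; rewrite mulg1 acte1.
by move=> /(congr1 (fun z => (phi 1%g e)^-1 * z)%g); rewrite mulKg mulVg.
Qed.

Lemma coc1 p : coc 1%g p = 1%g.
Proof. by elim: p => //= e p IHp; rewrite phi1. Qed.

Lemma eact1 p : eact 1%g p = p.
Proof. by elim: p => //= e p IHp; rewrite phi1 acte1 IHp. Qed.

Lemma cocM g h p : coc (g * h)%g p = (coc g (eact h p) * coc h p)%g.
Proof. by elim: p g h => //= e p IHp g h; rewrite phiM IHp. Qed.

Lemma eactM g h p : eact (g * h)%g p = eact g (eact h p).
Proof. by elim: p g h => //= e p IHp g h; rewrite acteM phiM IHp. Qed.

Lemma cocV g p : coc g^-1%g (eact g p) = (coc g p)^-1%g.
Proof.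
have := cocM g^-1%g g p; rewrite mulVg coc1 => /(congr1 (fun z => z * (coc g p)^-1)%g).
by rewrite mul1g mulgK.
Qed.

Lemma eactK g p : eact g^-1%g (eact g p) = p.
Proof. by rewrite -eactM mulVg eact1. Qed.

Lemma plast_eact g v p : plast (g *v v) (eact g p) = g *v plast v p.
Proof.
elim: p g v => //= e p IHp g v; rewrite /plast /= -!/(plast _ _) act_sr.
by rewrite -(phi_actv g e) IHp phi_actv.
Qed.

Lemma is_path_eact g v p : is_path v p -> is_path (g *v v) (eact g p).
Proof.
elim: p g v => //= e p IHp g v /andP[/eqP<- pP].
by rewrite act_rg eqxx act_sr -(phi_actv g e) IHp.
Qed.

Definition pact g a : fpath E :=
  @FPath E (g *v prg a, eact g (pedges a))
    (is_path_eact g (fpathP a)).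

Lemma psr_pact g a : psr (pact g a) = g *v psr a.
Proof. exact: plast_eact. Qed.

Lemma iact_subproof g x n :
  sr (coc g (mkseq x n) *e x n) = rg (coc g (mkseq x n.+1) *e x n.+1).
Proof.
by rewrite act_sr act_rg mkseqSc coc_cat /= phi_actv ipathP.
Qed.
Definition iact g x : ipath E := IPath (iact_subproof g x).

Lemma mkseq_iact g x n : mkseq (iact g x) n = eact g (mkseq x n).
Proof.
by elim: n => // n IHn; rewrite !mkseqSc eact_cat IHn.
Qed.

Lemma irg_iact g x : irg (iact g x) = g *v irg x.
Proof. by rewrite /irg /= act_rg. Qed.

Local Open Scope nat_scope.

Record striple := STriple {
  striple_val : fpath E * G * fpath E;
  striple_valP : psr striple_val.1.1 == striple_val.1.2 *v psr striple_val.2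
}.
HB.instance Definition _ := [isSub for striple_val].
HB.instance Definition _ := [Countable of striple by <:].

Definition ta (t : striple) : fpath E := (val t).1.1.
Definition tg (t : striple) : G := (val t).1.2.
Definition tb (t : striple) : fpath E := (val t).2.

(* [None] is the zero of the semigroup. *)
Definition sge : Type := option striple.

(* The element (a,g,b); None unless s(a) = g.s(b). *)
Definition sgeT a g b : sge := insub (a, g, b).

Definition smul (s t : sge) : sge :=
  match s, t with
  | Some s, Some t =>
    if fprefix (tb s) (ta t) then
      let c := fdrop (plen (tb s)) (ta t) in
      sgeT (fcat (ta s) (pact (tg s) c)) (coc (tg s) (pedges c) * tg t)%g (tb t)
    else if fprefix (ta t) (tb s) then
      let c := fdrop (plen (ta t)) (tb s) in
      sgeT (ta s) (tg s * (coc (tg t)^-1 (pedges c))^-1)%g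
           (fcat (tb t) (pact (tg t)^-1%g c))
    else None
  | _, _ => None
  end.

Lemma tinv_subproof (t : striple) : psr (tb t) == (tg t)^-1%g *v psr (ta t).
Proof. by rewrite (eqP (valP t)) -actvM mulVg actv1. Qed.
Definition tinv (t : striple) : striple :=
  @STriple (tb t, (tg t)^-1%g, ta t) (tinv_subproof t).

Definition sstar (s : sge) : sge := omap tinv s.

Definition sidem c : sge := sgeT c 1%g c.

Definition sdom (s : sge) : set (ipath E) := if s is Some s then cyl (tb s) else set0.

(* (a,g,b).(bx) = a(g.x); only meaningful on [sdom s] *)
Definition sact (s : sge) x : ipath E :=
  if s is Some s then icat (ta s) (iact (tg s) (ishift (plen (tb s)) x)) else x.

Lemma sgeT_vpath v g : psr (vpath v) = g *v psr (vpath (g^-1%g *v v)).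
Proof. by rewrite -[RHS](actvM (ss_act T) g g^-1%g v) mulgV actv1. Qed.

Lemma sgeT_epath e g : psr (epath e) = g *v psr (vpath (g^-1%g *v sr e)).
Proof. exact: (sgeT_vpath (sr e) g). Qed.

Arguments smul : simpl never.
Arguments sstar : simpl never.
Arguments sidem : simpl never.
Arguments sact : simpl never.

Lemma stripleP (t : striple) : psr (ta t) = tg t *v psr (tb t).
Proof. exact/eqP/(valP t). Qed.

Lemma sgeTE a g b : psr a = g *v psr b ->
  exists t, [/\ sgeT a g b = Some t, ta t = a, tg t = g & tb t = b].
Proof.
move=> ab; rewrite /sgeT; case: insubP => [t _ tE|/eqP //].
by exists t; rewrite /ta /tg /tb tE.
Qed.

Lemma sgeT_inj a g b a' g' b' : psr a = g *v psr b ->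
  sgeT a g b = sgeT a' g' b' -> [/\ a = a', g = g' & b = b'].
Proof.
move=> /sgeTE[t [-> <- <- <-]]; rewrite /sgeT; case: insubP => // u _ uE [tu].
by subst u; rewrite /ta /tg /tb uE.
Qed.

Lemma sgeT_val (t : striple) : sgeT (ta t) (tg t) (tb t) = Some t.
Proof.
have [u [-> ua ug ub]] := sgeTE (stripleP t); congr Some; apply: val_inj.
rewrite [LHS]surjective_pairing [(val u).1]surjective_pairing.
rewrite [RHS]surjective_pairing [(val t).1]surjective_pairing.
by rewrite -!/(ta _) -!/(tg _) -!/(tb _) ua ug ub.
Qed.

Lemma sact_cyl (s : striple) x : cyl (tb s) x -> cyl (ta s) (sact (Some s) x).
Proof.
move=> /cyl_shift[xb _]; exists (iact (tg s) (ishift (plen (tb s)) x)) => //=.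
by rewrite irg_iact xb stripleP.
Qed.

(* The invariant used to reason on germs: for x in [cyl b] and N >= |b|, writing
   x = bpy with |bp| = N, (a,g,b).x = a(g.p)(phi(g,p).y). *)
Definition jetp (s : striple) x N : seq Ed := drop (plen (tb s)) (mkseq x N).
Definition jetL (s : striple) x N : seq Ed :=
  pedges (ta s) ++ eact (tg s) (jetp s x N).
Definition jetk (s : striple) x N : G := coc (tg s) (jetp s x N).

Lemma mkseq_add x N m : mkseq x (N + m) = mkseq x N ++ mkseq (ishift N x) m.
Proof.
elim: m => [|m IHm]; first by rewrite addn0 cats0.
by rewrite addnS !mkseqSc IHm catA.
Qed.

Lemma jetp_add s x N m : plen (tb s) <= N ->
  jetp s x (N + m) = jetp s x N ++ mkseq (ishift N x) m.
Proof.
move=> sN; rewrite /jetp mkseq_add drop_cat size_mkseq.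
move: sN; rewrite leq_eqVlt => /orP[/eqP->|->] //.
by rewrite ltnn subnn drop0 drop_oversize ?size_mkseq.
Qed.

Lemma jetL_add s x N m : plen (tb s) <= N ->
  jetL s x (N + m) = jetL s x N ++ eact (jetk s x N) (mkseq (ishift N x) m).
Proof. by move=> sN; rewrite /jetL jetp_add // eact_cat catA. Qed.

Lemma jetk_add s x N m : plen (tb s) <= N ->
  jetk s x (N + m) = coc (jetk s x N) (mkseq (ishift N x) m).
Proof. by move=> sN; rewrite /jetk jetp_add // coc_cat. Qed.

Lemma cyl_jetp s x N : cyl (tb s) x -> plen (tb s) <= N ->
  mkseq x N = pedges (tb s) ++ jetp s x N.
Proof.
move=> /cylP[_ xb] sN; rewrite -(subnKC sN); move: (N - _)%N => m.
by rewrite /jetp mkseq_add xb drop_size_cat.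
Qed.

Lemma size_jetL s x N : size (jetL s x N) = (plen (ta s) + (N - plen (tb s)))%N.
Proof. by rewrite size_cat size_eact size_drop size_mkseq. Qed.

Lemma mkseq_sact (s : striple) x N : cyl (tb s) x -> plen (tb s) <= N ->
  mkseq (sact (Some s) x) (size (jetL s x N)) = jetL s x N.
Proof.
move=> xs sN; have /cylP[_ ya] := sact_cyl xs; have [xb xE] := cyl_shift xs.
rewrite size_jetL mkseq_add ya; congr cat; rewrite [sact _ _]/(icat _ _).
rewrite ishift_icat ?irg_iact ?xb ?stripleP // mkseq_iact; congr eact.
rewrite -{2}(subnKC sN); move: (N - _)%N => m.
by rewrite /jetp mkseq_add drop_size_cat // size_mkseq.
Qed.

Lemma jet_path s x N : cyl (tb s) x -> plen (tb s) <= N ->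
  is_path (prg (ta s)) (jetL s x N) /\
  plast (prg (ta s)) (jetL s x N) = jetk s x N *v rg (x N).
Proof.
move=> xs sN; have xN := cyl_jetp xs sN; have [xr _] := xs; have /cylP[x0 _] := xs.
have pP : is_path (psr (tb s)) (jetp s x N).
  by have := is_path_mkseq x N; rewrite xN is_path_cat x0 => /andP[].
rewrite /jetL is_path_cat fpathP -/(psr _) stripleP is_path_eact //; split=> //.
rewrite plast_cat -/(psr _) stripleP plast_eact /jetk coc_actv; congr (_ *v _).
by rewrite -plast_mkseq xN plast_cat x0.
Qed.

Lemma is_path_src p v v' : is_path v p -> is_path v' p ->
  plast v p = plast v' p -> v = v'.
Proof. by case: p => //= e p /andP[/eqP<- _] /andP[/eqP<-]. Qed.

Lemma jet_prg s t x N : cyl (tb s) x -> cyl (tb t) x ->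
  plen (tb s) <= N -> plen (tb t) <= N ->
  jetL s x N = jetL t x N -> jetk s x N = jetk t x N -> prg (ta s) = prg (ta t).
Proof.
move=> xs xt sN tN eL ek; have [sP sl] := jet_path xs sN; have [tP tl] := jet_path xt tN.
by apply: (@is_path_src (jetL s x N)); rewrite ?sl ?ek // eL.
Qed.

Lemma jet_sact s t x N : cyl (tb s) x -> cyl (tb t) x ->
  plen (tb s) <= N -> plen (tb t) <= N ->
  jetL s x N = jetL t x N -> jetk s x N = jetk t x N ->
  sact (Some s) x = sact (Some t) x.
Proof.
move=> xs xt sN tN eL ek; apply: ipath_inj => n.
have : jetL s x (N + n.+1) = jetL t x (N + n.+1).
  by rewrite !jetL_add // eL ek.
have sN' : plen (tb s) <= N + n.+1 by rewrite (leq_trans sN) ?leq_addr.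
have tN' : plen (tb t) <= N + n.+1 by rewrite (leq_trans tN) ?leq_addr.
move=> e; have := mkseq_sact xt tN'; have := mkseq_sact xs sN'; rewrite e => h1 h2.
have nL : n < size (jetL t x (N + n.+1)).
  rewrite size_jetL; apply: leq_trans (leq_addl _ _).
  by rewrite addnC -addnBA // leq_addr.
by move: (congr1 (fun p => nth (x 0) p n) (etrans h1 (esym h2))); rewrite !nth_mkseq.
Qed.

Lemma smul_sidem_long (s : striple) x N : cyl (tb s) x -> plen (tb s) <= N ->
  exists u, [/\ smul (Some s) (sidem (itake N x)) = Some u, prg (ta u) = prg (ta s),
    pedges (ta u) = jetL s x N, tg u = jetk s x N & tb u = itake N x].
Proof.
move=> xs sN; rewrite /sidem.
have [t [-> t1 t2 t3]] : exists t, [/\ sgeT (itake N x) 1%g (itake N x) = Some t,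
  ta t = itake N x, tg t = 1%g & tb t = itake N x] by apply: sgeTE; rewrite actv1.
rewrite /smul t1 t2 t3 mulg1; have /cylP[x0 _] := xs.
have -> : fprefix (tb s) (itake N x).
  rewrite /fprefix -x0 eqxx; apply/prefixP; exists (jetp s x N).
  exact: cyl_jetp.
set c := fdrop _ _.
have pc : pedges c = jetp s x N by [].
have rc : prg c = psr (tb s).
  rewrite /c prg_fdrop /pedges /= (cyl_jetp xs sN) take_size_cat //.
  by rewrite /psr -x0.
have sc : psr c = rg (x N).
  by rewrite /psr rc pc -plast_mkseq (cyl_jetp xs sN) plast_cat x0.
have ac : psr (ta s) = prg (pact (tg s) c) by rewrite stripleP -rc.
have [|u [-> u1 u2 u3]] := @sgeTE (fcat (ta s) (pact (tg s) c)) (coc (tg s) (pedges c)) (itake N x).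
  by rewrite psr_fcat // psr_pact coc_actv sc /psr plast_mkseq.
by exists u; rewrite u1 u2 u3 prg_fcat // pedges_fcat.
Qed.

Lemma smul_sidem_short (s : striple) x n : cyl (tb s) x -> n < plen (tb s) ->
  smul (Some s) (sidem (itake n x)) = Some s.
Proof.
move=> xs ns; rewrite /sidem.
have [t [-> t1 t2 t3]] : exists t, [/\ sgeT (itake n x) 1%g (itake n x) = Some t,
  ta t = itake n x, tg t = 1%g & tb t = itake n x] by apply: sgeTE; rewrite actv1.
rewrite /smul t1 t2 t3 invg1; have /cylP[x0 xE] := xs.
have -> : fprefix (tb s) (itake n x) = false.
  apply/negP => /andP[_ /size_prefix].
  by rewrite size_mkseq leqNgt ns.
have xpre : fprefix (itake n x) (tb s).
  rewrite /fprefix -x0 eqxx -xE -(subnKC (ltnW ns)) mkseq_add.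
  by apply/prefixP; exists (mkseq (ishift n x) (plen (tb s) - n)).
rewrite xpre; have [sc bE] := fcat_fdrop xpre; set c := fdrop _ _ in sc bE *.
rewrite coc1 invg1 mulg1.
have -> : pact 1%g c = c by apply: fpath_inj;
    [exact: (actv1 (ss_act T) (prg c))|exact: (eact1 (pedges c))].
by rewrite -bE sgeT_val.
Qed.

Record pregerm := PreGerm {
  pgs : striple;
  pgx : ipath E;
  pgP : cyl (tb pgs) pgx
}.
HB.instance Definition _ := gen_eqMixin pregerm.
HB.instance Definition _ := gen_choiceMixin pregerm.

Definition germ_eq (p q : pregerm) : Prop :=
  pgx p = pgx q /\
  exists2 c, cyl c (pgx p) &
    smul (Some (pgs p)) (sidem c) = smul (Some (pgs q)) (sidem c).

Definition jet_eq (p q : pregerm) N : Prop :=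
  [/\ plen (tb (pgs p)) <= N, plen (tb (pgs q)) <= N,
      jetL (pgs p) (pgx p) N = jetL (pgs q) (pgx q) N
    & jetk (pgs p) (pgx p) N = jetk (pgs q) (pgx q) N].

Lemma jet_eq_leq (p q : pregerm) N M : pgx p = pgx q -> N <= M -> jet_eq p q N -> jet_eq p q M.
Proof.
move=> pq NM [pN qN eL ek]; split; rewrite ?(leq_trans _ NM) //.
  by rewrite -(subnKC NM) !jetL_add // eL ek pq.
by rewrite -(subnKC NM) !jetk_add // ek pq.
Qed.

Lemma germ_eqP (p q : pregerm) :
  germ_eq p q <-> pgx p = pgx q /\ exists N, jet_eq p q N.
Proof.
case: p q => [s x xs] [t y yt]; rewrite /germ_eq /jet_eq /=.
split=> -[xy]; subst y; last first.
  move=> [N [sN tN eL ek]]; split=> //; exists (itake N x); first exact: cyl_itake.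
  have [u [-> u0 u1 u2 u3]] := smul_sidem_long xs sN.
  have [w [-> w0 w1 w2 w3]] := smul_sidem_long yt tN.
  have r := jet_prg xs yt sN tN eL ek.
  rewrite -(sgeT_val u) -(sgeT_val w); congr sgeT; last by rewrite u3 w3.
    by apply: fpath_inj; rewrite ?u0 ?w0 ?u1 ?w1.
  by rewrite u2 w2.
move=> [c xc e]; split=> //.
have cE : c = itake (plen c) x.
  by have /cylP[x0 xE] := xc; apply: fpath_inj; [rewrite -x0|rewrite -xE].
move: e; rewrite cE; set N := plen c => e.
case: (leqP (plen (tb s)) N) (leqP (plen (tb t)) N) => sN [] tN.
- exists N; have [u [eu u0 u1 u2 u3]] := smul_sidem_long xs sN.
  have [w [ew w0 w1 w2 w3]] := smul_sidem_long yt tN.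
  move: e; rewrite eu ew => -[uw]; split=> //; last by rewrite -u2 -w2 uw.
  by rewrite -u1 -w1 uw.
- have [u [eu u0 u1 u2 u3]] := smul_sidem_long xs sN.
  move: e; rewrite eu smul_sidem_short // => -[ut].
  by move: tN; rewrite -ut u3 /plen size_mkseq ltnn.
- have [u [eu u0 u1 u2 u3]] := smul_sidem_long yt tN.
  move: e; rewrite eu smul_sidem_short // => -[ut].
  by move: sN; rewrite ut u3 /plen size_mkseq ltnn.
- move: e; rewrite !smul_sidem_short // => -[st].
  by exists (plen (tb s)); rewrite -st.
Qed.

Lemma germ_refl (p : pregerm) : germ_eq p p.
Proof. by split=> //; exists (tb (pgs p)) => //; exact: pgP. Qed.

Lemma germ_sym (p q : pregerm) : germ_eq p q -> germ_eq q p.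
Proof. by move=> [pq [c xc e]]; split=> //; exists c; rewrite -?pq. Qed.

Lemma germ_trans (p q r : pregerm) : germ_eq p q -> germ_eq q r -> germ_eq p r.
Proof.
move=> /germ_eqP[pq [N pqN]] /germ_eqP[qr [M qrM]].
apply/germ_eqP; split; first by rewrite pq.
have [pL _ eL ek] := jet_eq_leq pq (leq_maxl N M) pqN.
have [_ rL eL' ek'] := jet_eq_leq qr (leq_maxr N M) qrM.
by exists (maxn N M); split=> //; rewrite ?eL ?ek.
Qed.

Record Gtight := GTight {
  gclass : set pregerm;
  gclassP : exists p : pregerm, gclass = germ_eq p
}.
HB.instance Definition _ := gen_eqMixin Gtight.
HB.instance Definition _ := gen_choiceMixin Gtight.

Definition gpi (p : pregerm) : Gtight := GTight (ex_intro _ p erefl).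
Definition grepr (z : Gtight) : pregerm := projT1 (cid (gclassP z)).

Lemma pi_eqP (p q : pregerm) : gpi p = gpi q <-> germ_eq p q.
Proof.
split=> [[->]|pq]; first exact: germ_refl.
have e : germ_eq p = germ_eq q.
  apply/funext => r; apply/propext; split; last exact: germ_trans.
  exact: germ_trans (germ_sym pq).
rewrite /gpi; move: (ex_intro _ p _) (ex_intro _ q _); rewrite e => h h'.
by rewrite (Prop_irrelevance h h').
Qed.

Lemma greprK z : gpi (grepr z) = z.
Proof.
rewrite /grepr; case: cid => p /= zE; case: z zE => P h /= PE; subst P.
by rewrite /gpi; congr GTight; exact: Prop_irrelevance.
Qed.

(* The germ [s,x]; None unless x is in the domain of s. *)
Definition germ (s : sge) x : option Gtight :=
  if s is Some t then
    if pselect (cyl (tb t) x) is left xt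
    then Some (gpi (PreGerm xt)) else None
  else None.

Definition gsrc (z : Gtight) : ipath E := pgx (grepr z).
Definition grng (z : Gtight) : ipath E := sact (Some (pgs (grepr z))) (gsrc z).

(* The product is defined exactly on the composable pairs, see [gmulE]. *)
Definition gmul (z1 z2 : Gtight) : option Gtight :=
  if gsrc z1 == grng z2 then
    germ (smul (Some (pgs (grepr z1))) (Some (pgs (grepr z2)))) (gsrc z2)
  else None.

Definition ginv (z : Gtight) : Gtight :=
  gpi
    (@PreGerm (tinv (pgs (grepr z))) _ (sact_cyl (pgP (grepr z)))).

Definition Theta (s : sge) : set Gtight := [set z | exists x, germ s x = Some z].

Lemma germ_dom s x : (exists z, germ s x = Some z) <-> sdom s x.
Proof.
rewrite /germ /sdom; case: s => [t|]; last by split=> // -[].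
case: pselect => xt; split=> //; last by case.
by move=> _; eexists.
Qed.

Lemma pi_germ (p : pregerm) : germ (Some (pgs p)) (pgx p) = Some (gpi p).
Proof.
case: p => t x xt /=; case: pselect => // xt'.
by rewrite (Prop_irrelevance xt' xt).
Qed.

Lemma germ_pi s x z : germ s x = Some z ->
  exists p : pregerm, [/\ s = Some (pgs p), x = pgx p & z = gpi p].
Proof.
by case: s => //= t; case: pselect => // xt [<-]; exists (PreGerm xt).
Qed.

(* [s,x] = [t,y] iff x = y and se = te for some idempotent e with x in its domain. *)
Lemma germP s t x y : sdom s x -> sdom t y ->
  germ s x = germ t y <->
  x = y /\ exists2 c, cyl c x & smul s (sidem c) = smul t (sidem c).
Proof.
case: s t => [s|//] [t|//] xs yt.
have := pi_germ (PreGerm xs); have := pi_germ (PreGerm yt) => /= -> ->.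
by split=> [/Some_inj/pi_eqP//|e]; congr Some; apply/pi_eqP.
Qed.

Lemma grepr_jet s x z : germ s x = Some z ->
  exists p : pregerm, [/\ s = Some (pgs p), x = pgx p, gsrc z = x
    & exists N, jet_eq (grepr z) p N].
Proof.
case/germ_pi => p [-> -> zp]; exists p.
have /germ_eqP[e [N jN]] : germ_eq (grepr z) p by apply/pi_eqP; rewrite greprK.
by split=> //; exists N.
Qed.

Lemma germ_src s x z : germ s x = Some z -> gsrc z = x.
Proof. by move=> /grepr_jet[p []]. Qed.

Lemma germ_rng s x z : germ s x = Some z -> grng z = sact s x.
Proof.
move=> /grepr_jet[p [-> -> zx [N [zN pN eL ek]]]]; rewrite /grng.
have e : pgx (grepr z) = pgx p by rewrite -zx.
rewrite zx; apply: (@jet_sact _ _ _ N) => //; rewrite -?e //; first exact: pgP.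
  by rewrite e; exact: pgP.
- by rewrite {2}e.
- by rewrite {2}e.
Qed.

Lemma tinv_jet (s : striple) x N : cyl (tb s) x -> plen (tb s) <= N ->
  let y := sact (Some s) x in let M := size (jetL s x N) in
  [/\ plen (tb (tinv s)) <= M, jetL (tinv s) y M = mkseq x N
    & jetk (tinv s) y M = (jetk s x N)^-1%g].
Proof.
move=> xs sN y M; have sM : plen (tb (tinv s)) <= M by rewrite /M size_jetL leq_addr.
have pE : jetp (tinv s) y M = eact (tg s) (jetp s x N).
  by rewrite /jetp mkseq_sact // /jetL drop_size_cat.
split=> //; last by rewrite /jetk pE cocV.
by rewrite /jetL pE eactK -cyl_jetp.
Qed.

Lemma ginvE s x z : germ s x = Some z -> germ (sstar s) (sact s x) = Some (ginv z).
Proof.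
move=> sz; have yE := germ_rng sz; have [p [sp xp zx [N [zN pN eL ek]]]] := grepr_jet sz.
have e : pgx (grepr z) = pgx p by rewrite -xp -zx.
subst s x.
have := pi_germ (PreGerm (sact_cyl (pgP p) : cyl (tb (tinv (pgs p))) _)).
rewrite /sstar /= => ->; congr Some; apply/pi_eqP/germ_eqP; split; first exact/esym.
have [j1 j2 j3] := tinv_jet (pgP p) pN; have [k1 k2 k3] := tinv_jet (pgP (grepr z)) zN.
exists (size (jetL (pgs p) (pgx p) N)); split=> //=.
- by rewrite -eL.
- by rewrite j2 -eL k2 e.
- by rewrite j3 -eL k3 ek.
Qed.

Lemma smul_jet (s t : striple) x :
  cyl (tb t) x -> cyl (tb s) (sact (Some t) x) ->
  exists u, [/\ smul (Some s) (Some t) = Some u, cyl (tb u) x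
    & exists N0, forall N, N0 <= N ->
      let M := size (jetL t x N) in
      [/\ plen (tb u) <= N, plen (tb t) <= N, plen (tb s) <= M,
          jetL u x N = jetL s (sact (Some t) x) M
        & jetk u x N = (jetk s (sact (Some t) x) M * jetk t x N)%g]].
Proof.
move=> xt ys; set y := sact _ _ in ys *.
have /cylP[yt yT] : cyl (ta t) y := sact_cyl xt.
have /cylP[yr yS] := ys.
rewrite /smul; case: ifPn => [bpre|bnpre].
  have [sc tE] := fcat_fdrop bpre; set c := fdrop _ _ in sc tE *.
  have tcE : pedges (ta t) = pedges (tb s) ++ pedges c by rewrite {1}tE pedges_fcat.
  have ac : psr (ta s) = prg (pact (tg s) c) by rewrite stripleP sc.
  have [|u [-> u1 u2 u3]] :=
      @sgeTE (fcat (ta s) (pact (tg s) c)) (coc (tg s) (pedges c) * tg t)%g (tb t).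
    rewrite psr_fcat // psr_pact actvM coc_actv -stripleP.
    by rewrite -(psr_fcat sc) -tE.
  exists u; split=> //; first by rewrite u3.
  exists (plen (tb t)) => N tN /=; set M := size _; rewrite u3.
  have M1 : plen (ta t) <= M by rewrite /M size_jetL leq_addr.
  have sM : plen (tb s) <= M.
    by apply: leq_trans M1; rewrite /plen tcE size_cat leq_addr.
  have uE : jetp u x N = jetp t x N by rewrite /jetp u3.
  have sE : jetp s y M = pedges c ++ eact (tg t) (jetp t x N).
    by rewrite {1}/jetp mkseq_sact // /jetL tcE -catA drop_size_cat.
  split=> //.
    by rewrite /jetL u1 u2 uE sE pedges_fcat // eactM eact_cat catA.
  by rewrite /jetk u2 uE sE cocM coc_cat.
have st : plen (ta t) < plen (tb s).
  rewrite ltnNge; apply: contra bnpre => le.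
  rewrite /fprefix -yr -yt eqxx -yS -yT -(subnKC le) mkseq_add.
  exact: prefix_prefix.
have tpre : fprefix (ta t) (tb s).
  rewrite /fprefix -yr -yt eqxx -yS -yT -(subnKC (ltnW st)) mkseq_add.
  exact: prefix_prefix.
rewrite tpre; have [tc sE] := fcat_fdrop tpre; set c := fdrop _ _ in tc sE *.
have scE : pedges (tb s) = pedges (ta t) ++ pedges c by rewrite {1}sE pedges_fcat.
pose N0 := plen (tb t) + plen c.
have tN0 : plen (tb t) <= N0 by rewrite leq_addr.
have sz0 : size (jetL t x N0) = plen (tb s).
  by rewrite size_jetL addKn /plen scE size_cat.
have P0 : eact (tg t) (jetp t x N0) = pedges c.
  have := mkseq_sact xt tN0; rewrite sz0 -/y yS scE /jetL.
  by move=> /eqP; rewrite eqseq_cat // eqxx => /eqP.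
have P0' : jetp t x N0 = eact (tg t)^-1%g (pedges c) by rewrite -P0 eactK.
have k0 : (coc (tg t)^-1%g (pedges c))^-1%g = jetk t x N0 by rewrite -P0 cocV invgK.
have bc : psr (tb t) = prg (pact (tg t)^-1%g c).
  by rewrite [RHS](_ : _ = (tg t)^-1%g *v prg c) // -tc stripleP -actvM mulVg actv1.
have [|u [-> u1 u2 u3]] := @sgeTE (ta s)
    (tg s * (coc (tg t)^-1%g (pedges c))^-1)%g (fcat (tb t) (pact (tg t)^-1%g c)).
  rewrite psr_fcat // psr_pact actvM k0 /jetk coc_actv -[tg t *v _]actvM mulgV actv1.
  by rewrite stripleP -(psr_fcat tc) -sE.
have uL : plen (tb u) = N0.
  by rewrite /plen u3 pedges_fcat // size_cat size_eact.
have /cylP[xr xT] := xt.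
exists u; split=> //.
  apply/cylP; rewrite uL u3 prg_fcat // pedges_fcat // -xr; split=> //.
  by rewrite (cyl_jetp xt tN0) P0'.
exists N0 => N N0N /=; set M := size _.
have tN : plen (tb t) <= N := leq_trans tN0 N0N.
have [m Nm] : exists m, N = N0 + m by exists (N - N0); rewrite subnKC.
have sM : plen (tb s) <= M.
  by rewrite /M Nm jetL_add // size_cat sz0 leq_addr.
have uE : jetp u x N = mkseq (ishift N0 x) m.
  by rewrite /jetp Nm mkseq_add drop_size_cat // size_mkseq uL.
have sE' : jetp s y M = eact (jetk t x N0) (mkseq (ishift N0 x) m).
  rewrite {1}/jetp mkseq_sact // Nm jetL_add // drop_size_cat //.
split=> //; rewrite ?uL //.
  by rewrite /jetL u1 u2 uE sE' k0 eactM.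
by rewrite /jetk -/(jetk t x N) u2 uE sE' k0 cocM Nm jetk_add.
Qed.

Lemma gmulE s t x z1 z2 :
  germ s (sact t x) = Some z1 -> germ t x = Some z2 ->
  exists2 z, gmul z1 z2 = Some z & germ (smul s t) x = Some z.
Proof.
move=> g1 g2; rewrite /gmul (germ_src g1) (germ_rng g2) eqxx (germ_src g2).
have y2 := germ_rng g2.
have [p1 [sE yE z1y [N1 j1]]] := grepr_jet g1; have [p2 [tE xE z2x [N2 j2]]] := grepr_jet g2.
subst s t.
have ex : pgx (grepr z2) = x := z2x.
have ey : pgx (grepr z1) = sact (Some (pgs p2)) x := z1y.
have eyr : sact (Some (pgs (grepr z2))) x = sact (Some (pgs p2)) x.
  by rewrite -y2 /grng z2x.
have xp2 : cyl (tb (pgs p2)) x by rewrite xE; exact: pgP.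
have xr2 : cyl (tb (pgs (grepr z2))) x by rewrite -ex; exact: pgP.
have yp1 : cyl (tb (pgs p1)) (sact (Some (pgs p2)) x) by rewrite yE; exact: pgP.
have yr1 : cyl (tb (pgs (grepr z1))) (sact (Some (pgs (grepr z2))) x).
  by rewrite eyr -ey; exact: pgP.
have [u [uE xu [Nu uj]]] := smul_jet xp2 yp1.
have [w [wE xw [Nw wj]]] := smul_jet xr2 yr1.
have := pi_germ (PreGerm xu); have := pi_germ (PreGerm xw) => /= gw gu.
exists (gpi (PreGerm xu)); last by rewrite uE.
rewrite wE /= gw; congr Some; apply/pi_eqP/germ_eqP; split=> //.
pose N := maxn (maxn Nu Nw) (maxn N2 (N1 + plen (tb (pgs p2)))).
have le_u : Nu <= N by rewrite /N !leq_max leqnn.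
have le_w : Nw <= N by rewrite /N !leq_max leqnn !orbT.
have le_2 : N2 <= N by rewrite /N !leq_max leqnn !orbT.
have le_1 : N1 + plen (tb (pgs p2)) <= N by rewrite /N !leq_max leqnn !orbT.
have [] := jet_eq_leq (etrans z2x xE) le_2 j2; rewrite ex -xE => _ _ L2 k2.
have [uN tN sM uL uk] := uj N le_u; have [wN _ _ wL wk] := wj N le_w.
have M1 : N1 <= size (jetL (pgs p2) x N).
  rewrite size_jetL; apply: leq_trans (leq_addl _ _).
  by rewrite leq_subRL // addnC.
have [] := jet_eq_leq (etrans z1y yE) M1 j1; rewrite ey -yE => _ _ L1 k1.
exists N; split=> //=.
  by rewrite wL uL eyr L2 L1.
by rewrite wk uk eyr L2 k1 k2.
Qed.

Lemma gmul_dom z1 z2 : (exists z, gmul z1 z2 = Some z) <-> gsrc z1 = grng z2.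
Proof.
split=> [[z]|e]; first by rewrite /gmul; case: ifP => // /eqP.
have g2 : germ (Some (pgs (grepr z2))) (gsrc z2) = Some z2 by rewrite pi_germ greprK.
have g1 : germ (Some (pgs (grepr z1))) (gsrc z1) = Some z1 by rewrite pi_germ greprK.
move: g1; rewrite e (germ_rng g2) => g1.
by have [z -> _] := gmulE g1 g2; exists z.
Qed.

HB.instance Definition _ :=
  isSubBaseTopological.Build Gtight (range Theta) (@id (set Gtight)).

Definition bisection (B : set Gtight) : Prop :=
  {in B &, injective gsrc} /\ {in B &, injective grng}.

Definition compact_open_bisection (B : set Gtight) : Prop :=
  [/\ compact B, open B & bisection B].

Section Steinberg.
Context (R : comStarRingType).
Local Open Scope ring_scope.

(* The finitary sum is the full sum over all factorizations z1 z2 = z when only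
   finitely many terms are nonzero, as is the case on the Steinberg algebra. *)
Definition conv (f1 f2 : Gtight -> R) (z : Gtight) : R :=
  \sum_(zz \in [set zz : Gtight * Gtight | gmul zz.1 zz.2 = Some z])
    f1 zz.1 * f2 zz.2.

Definition conv_star (f1 : Gtight -> R) (z : Gtight) : R := conjr (f1 (ginv z)).

(* A_R(G_tight), as a subset of the functions from G_tight to R *)
Definition steinberg : set (Gtight -> R) :=
  [set f1 | exists n (c : 'I_n -> R) (B : 'I_n -> set Gtight),
    (forall i, compact_open_bisection (B i)) /\
    f1 = (fun z => \sum_(i < n) c i * \1_(B i) z)].

(* A *-homomorphism from A to A_R(G_tight) *)
Record steinberg_hom (A : starAlgType R) (k : A -> (Gtight -> R)) : Prop :=
  SteinbergHom {
    steinberg_hom_in : forall a : A, steinberg (k a);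
    steinberg_hom_linear : forall (r : R) (a b : A) z, k (r *: a + b) z = r * k a z + k b z;
    steinberg_hom_mul : forall a b : A, k (a ** b) = conv (k a) (k b);
    steinberg_hom_star : forall a : A, k (star a) = conv_star (k a)
  }.

End Steinberg.

End TightGroupoid.

(* Main.v *)
Require Import Defs.
From HB Require Import structures.
From mathcomp Require Import all_boot all_order all_algebra.
From mathcomp Require Import all_classical.
From mathcomp Require Import topology numfun.
From mathcomp Require Import finmap zify.

(* The sets [Theta s] multiply like the inverse semigroup: for the convolution
   product 1_{Theta s} * 1_{Theta t} = 1_{Theta (st)}, and the involution sends
   1_{Theta s} to 1_{Theta s^*}. Hence the linear span of these indicators is a
   *-algebra, whose axioms reduce to identities between germs. It lies inside
   the Steinberg algebra because each [Theta s] is a compact open bisection,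
   where compactness follows from row-finiteness by an ultrafilter argument.
   The triples attached to the generators form a (G,E)-family in this span
   ([v = sum S_e S_e^*] because an infinite path has a unique first edge), so
   the universal property gives the homomorphism. As there are no sources,
   every cylinder is nonempty, so the generators have nonzero images. *)

Set Implicit Arguments.
Unset Strict Implicit.

Import GRing.Theory.
Local Open Scope classical_set_scope.
Local Open Scope ring_scope.

#[local] Arguments smul : simpl never.
#[local] Arguments sact : simpl never.
#[local] Arguments sstar : simpl never.

(** * Germs of products and adjoints in the inverse semigroup *)

Section Germs.
Context (T : selfSimilarTriple).
Notation G := (ssG T).
Notation E := (ssE T).
Local Notation "g *v v" := (actv (ss_act T) g v) (at level 35, right associativity).
Local Notation "g *e e" := (acte (ss_act T) g e) (at level 35, right associativity).
Implicit Types (x y : ipath E) (s t u : sge T) (a b c : Defs.fpath E) (z : Gtight T).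
Local Open Scope nat_scope.

Lemma iactK (g : G) x : iact g^-1%g (iact g x) = x.
Proof.
apply: ipath_inj => n; have /(congr1 (fun p => nth (x 0) p n)) :
    mkseq (iact g^-1%g (iact g x)) n.+1 = mkseq x n.+1.
  by rewrite !mkseq_iact eactK.
by rewrite !nth_mkseq.
Qed.

Lemma tinvK : involutive (@tinv T).
Proof. by case=> [[[a g] b] tP]; apply: val_inj; rewrite /= /tg /= invgK. Qed.

Lemma sstarK : involutive (@sstar T).
Proof. by case=> // t; rewrite /sstar /= tinvK. Qed.

Lemma sdom_sact s x : sdom s x -> sdom (sstar s) (sact s x).
Proof. by case: s => // t; exact: sact_cyl. Qed.

Lemma sactK s x : sdom s x -> sact (sstar s) (sact s x) = x.
Proof.
case: s => // t xt; have [xb xE] := cyl_shift xt.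
rewrite /sact /= [ta (tinv t)]/ta [tg (tinv t)]/tg [tb (tinv t)]/tb /=.
by rewrite ishift_icat ?irg_iact ?xb ?stripleP // iactK.
Qed.

Lemma cyl_fcat a b x : psr a = prg b ->
  cyl (fcat a b) x <-> cyl a x /\ cyl b (ishift (plen a) x).
Proof.
move=> ab; rewrite !cylP prg_fcat // pedges_fcat // /plen pedges_fcat // size_cat.
rewrite mkseq_add irg_ishift -ab /psr.
split=> [[xa /eqP]|[[xa e1] [_ e2]]]; last by rewrite e1 e2.
rewrite eqseq_cat ?size_mkseq // => /andP[/eqP e1 /eqP e2].
by rewrite -plast_mkseq xa e1.
Qed.

(** The product represents composition of partial maps, although its definition only compares the
    paths [tb s] and [ta t]. One direction comes from [smul_jet], the other from the two prefix
    cases of the definition. *)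
Lemma sdom_smul s t x :
  sdom (smul s t) x <-> sdom t x /\ sdom s (sact t x).
Proof.
split=> [|[]]; last first.
  case: s t => [s|] [t|] //= xt xs.
  by have [u [-> xu _]] := smul_jet xt xs.
case: s t => [s|] [t|] //=; rewrite /smul; case: ifPn => [pre|_].
  have [cE tE] := fcat_fdrop pre.
  rewrite /sgeT; case: insubP => // u _ uE; rewrite /sdom /= {1}/tb uE /= => xt.
  split=> //; have := sact_cyl xt; rewrite tE => /cyl_fcat[] //.
case: ifPn => // pre; have [cE sE] := fcat_fdrop pre.
rewrite /sgeT; case: insubP => // u _ uE; rewrite /sdom /= {1}/tb uE /=.
have bE : psr (tb t) = prg (pact (tg t)^-1%g (fdrop (plen (ta t)) (tb s))).
  by rewrite -[RHS]/(_ *v _) -cE stripleP -actvM mulVg actv1.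
(* Here [x] continues [tb t] by the remainder twisted by the inverse of [tg t]. Acting by [t] undoes
   the twist, so the image starts with [ta t] followed by the remainder, which is [tb s]. *)
move=> /(cyl_fcat _ bE)[xt xc]; split=> //; rewrite sE cyl_fcat //.
split; first exact: sact_cyl.
have [xb xE] := cyl_shift xt.
rewrite /sact /= ishift_icat ?irg_iact ?xb ?stripleP //.
move: xc => /cylP[h1 h2]; apply/cylP; rewrite irg_iact h1 mkseq_iact; split.
  by rewrite -[prg (pact _ _)]/(_ *v _) -actvM mulgV actv1.
move: h2; rewrite [plen (pact _ _)](size_eact _ _) => ->.
by rewrite -[X in X = _]eactM mulgV eact1.
Qed.

(** The criterion of [germ_eqP], restated for semigroup elements at a common point. The value
    [False] at zero is harmless, because zero has empty domain. *)
Definition jets s t x :=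
  match s, t with
  | Some s, Some t =>
      exists N, [/\ plen (tb s) <= N, plen (tb t) <= N,
        jetL s x N = jetL t x N & jetk s x N = jetk t x N]
  | _, _ => False
  end.

Lemma eq_germP s t x : sdom s x -> sdom t x -> germ s x = germ t x <-> jets s t x.
Proof.
case: s t => [s|//] [t|//] xs xt.
have := pi_germ (PreGerm xs); have := pi_germ (PreGerm xt) => /= -> ->.
split=> [/Some_inj/pi_eqP/germ_eqP[]//|j].
by congr Some; apply/pi_eqP/germ_eqP; split.
Qed.

Lemma germ_undef s x : ~ sdom s x -> germ s x = None.
Proof.
by move=> ns; case e: germ => [z|//]; case: ns; apply/germ_dom; exists z.
Qed.

Lemma eq_germ s t x : (sdom s x <-> sdom t x) ->
  (sdom s x -> sdom t x -> jets s t x) -> germ s x = germ t x.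
Proof.
move=> st j; have [xs|ns] := pselect (sdom s x).
  by apply/eq_germP; [|apply/st|apply: j => //; apply/st].
by rewrite !germ_undef // -st.
Qed.

(** Infinite paths are determined by their initial segments, and [smul_jet] identifies arbitrarily
    long ones. *)
Lemma sact_smul s t x : sdom (smul s t) x -> sact (smul s t) x = sact s (sact t x).
Proof.
move=> /[dup] xu /sdom_smul[]; case: s t xu => [s|] [t|] //= xu xt xs.
move: xu; have [u [-> xu [N0 uN]]] := smul_jet xt xs => _.
(* At most [plen (tb u)] edges are lost in passing to the image, so the segments compared have more
   than [n] edges. *)
apply: ipath_inj => n; pose N := N0 + plen (tb u) + n.+1.
have [|uN' tN' sN' eL _] := uN N; first by rewrite /N -!addnA leq_addr.
have h1 := mkseq_sact xu uN'; have h2 := mkseq_sact xs sN'; rewrite -eL in h2.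
have nL : n < size (jetL u x N).
  by rewrite size_jetL; apply: leq_trans (leq_addl _ _); rewrite /N addnAC addnK leq_addl.
by move: (congr1 (fun p => nth (x 0) p n) (etrans h1 (esym h2))); rewrite !nth_mkseq.
Qed.

(** Working with germs avoids the prefix cases of a triple product: at a deep enough level jets
    compose like maps, and associativity becomes that of composition and of the group law. *)
Lemma germ_smulA s t u x : germ (smul (smul s t) u) x = germ (smul s (smul t u)) x.
Proof.
have dE : sdom (smul (smul s t) u) x <-> sdom (smul s (smul t u)) x.
  rewrite !sdom_smul; split=> [[xu [xt xs]]|[[xu xt] xs]].
    by do 2?[split=> //]; rewrite sact_smul // sdom_smul.
  by do 2?[split=> //]; rewrite -sact_smul // sdom_smul.
apply: eq_germ => // _ /[dup] xstu; rewrite !sdom_smul => -[[xu xt]].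
rewrite sact_smul ?sdom_smul //.
case: u t s xu xt xstu dE => [u|//] [t|//] [s|//] xu xt + + xs.
rewrite /sdom in xu xt xs.
have [st [stE xst [N1 h1]]] := smul_jet xt xs.
have [tu [tuE xtu [N2 h2]]] := smul_jet xu xt.
have xs' : cyl (tb s) (sact (Some tu) x) by rewrite -tuE sact_smul // tuE.
have [stu [stuE xstu [N3 h3]]] := smul_jet xu xst.
have [stu' [stuE' xstu' [N4 h4]]] := smul_jet xtu xs'.
rewrite stE tuE stuE stuE' => _ _.
(* Beyond every threshold; the summand [plen (tb u)] keeps the image under [u] longer than [N1], as
   [h1] is applied there. *)
pose N := N1 + plen (tb u) + N2 + N3 + N4.
have l1 : N1 <= size (jetL u x N).
  rewrite size_jetL; apply: leq_trans (leq_addl _ _).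
  by rewrite leq_subRL /N; lia.
have [] := h1 _ l1; have [| ] := h2 N; first by rewrite /N; lia.
have [| ] := h3 N; first by rewrite /N; lia.
have [| ] := h4 N; first by rewrite /N; lia.
move=> p1 p2 p3 p4 p5 q1 q2 q3 q4 q5 r1 r2 r3 r4 r5 w1 w2 w3 w4 w5.
have yE : sact (Some tu) x = sact (Some t) (sact (Some u) x) by rewrite -tuE sact_smul // tuE.
exists N; split=> //; first by rewrite q4 w4 p4 yE r4.
by rewrite q5 w5 p5 yE r4 r5 mulgA.
Qed.

Lemma sdom_sstar s x : sdom (sstar s) x <-> exists2 y, sdom s y & x = sact s y.
Proof.
split=> [xs|[y ys ->]]; last exact: sdom_sact.
exists (sact (sstar s) x); first by have := sdom_sact xs; rewrite sstarK.
by have := sactK xs; rewrite sstarK.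
Qed.

(** Any point of the domain on the left is the image of some [y] under [smul s t]. There [tinv_jet]
    turns the jets of the adjoints into inverses of the jets at [y], and the claim becomes the rule
    for inverting a product in the group. *)
Lemma germ_sstar_smul s t x :
  germ (sstar (smul s t)) x = germ (smul (sstar t) (sstar s)) x.
Proof.
apply: eq_germ => [|/sdom_sstar[y yst ->]].
  rewrite sdom_smul; split=> [/sdom_sstar[y yst ->]|[xs xt]].
    rewrite sact_smul //; move: yst => /sdom_smul[yt ys].
    by split; [exact: sdom_sact|rewrite sactK //; exact: sdom_sact].
  move: xs => /sdom_sstar[y ys xE]; move: xt; rewrite xE sactK // => /sdom_sstar[w wt yE].
  rewrite yE in ys *; have wst : sdom (smul s t) w by apply/sdom_smul.
  by rewrite -sact_smul //; exact: sdom_sact.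
rewrite sact_smul // => /[dup] /sdom_smul[]; move: yst => /[dup] yst /sdom_smul[].
case: s t yst => [s|//] [t|//] yst yt ys _ _ h.
have xs := sdom_sact ys; have xt := sdom_sact yt.
have yE := sactK ys; have uA := sact_smul yst.
move: h yst uA; have [u [-> yu [N1 h1]]] := smul_jet yt ys.
move: xs xt yE; rewrite -[sstar (Some s)]/(Some (tinv s)) -[sstar (Some t)]/(Some (tinv t)).
move=> xs xt yE.
have xt' : cyl (tb (tinv t)) (sact (Some (tinv s)) (sact (Some s) (sact (Some t) y))).
  by rewrite yE.
have [w [-> xw [N2 h2]]] := smul_jet xs xt' => _ _ uA.
rewrite -[sstar _]/(Some (tinv u)) /jets.
pose N := N1 + N2 + plen (tb t) + plen (tb s).
have [|uN tN sM uL uk] := h1 N; first by rewrite /N; lia.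
have [t1 t2 t3] := tinv_jet yt tN; have [s1 s2 s3] := tinv_jet ys sM.
have [u1 u2 u3] := tinv_jet yu uN.
(* The level used at the image point is the length to which the first [N] edges of [y] are sent, as
   [tinv_jet] prescribes. *)
have [|w1 w2 w3 w4 w5] := h2 (size (jetL s (sact (Some t) y) (size (jetL t y N)))).
  by rewrite !size_jetL /N; lia.
rewrite s2 size_mkseq yE in w3 w4 w5.
rewrite uA uL in u1 u2 u3.
exists (size (jetL s (sact (Some t) y) (size (jetL t y N)))); split=> //.
  by rewrite u2 w4 t2.
by rewrite u3 w5 t3 s3 uk invgM.
Qed.

Lemma ThetaE s z : Theta s z <-> germ s (gsrc z) = Some z.
Proof. by split=> [[x sz]|sz]; [rewrite (germ_src sz)|exists (gsrc z)]. Qed.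

Lemma eq_Theta s t : (forall x, germ s x = germ t x) -> Theta s = Theta t.
Proof. by move=> st; apply/seteqP; split=> z [x]; [rewrite st|rewrite -st]; exists x. Qed.

Lemma ex_germ z : exists t x, germ t x = Some z.
Proof. by exists (Some (pgs (grepr z))), (pgx (grepr z)); rewrite pi_germ greprK. Qed.

Lemma ginvK : involutive (@ginv T).
Proof.
move=> z; have [t [x tx]] := ex_germ z; have := ginvE (ginvE tx).
by rewrite sstarK sactK ?tx => [[]|]; last by apply/germ_dom; exists z.
Qed.

Lemma Theta_ginv s z : Theta s (ginv z) <-> Theta (sstar s) z.
Proof.
by split=> [] [x /ginvE]; rewrite ?ginvK ?sstarK; eexists; eassumption.
Qed.

(** A germ of [s] is determined by its source, and its source by its range, because [s] acts
    injectively. *)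
Lemma Theta_bisection s : bisection (Theta s).
Proof.
split=> z w /set_mem/ThetaE sz /set_mem/ThetaE sw e; first by move: sz; rewrite e sw => -[].
have dz : sdom s (gsrc z) by apply/germ_dom; exists z.
have dw : sdom s (gsrc w) by apply/germ_dom; exists w.
have : gsrc z = gsrc w.
  by rewrite -(sactK dz) -(sactK dw) -(germ_rng sz) -(germ_rng sw) e.
by move=> e'; move: sz; rewrite e' sw => -[].
Qed.

(** The jets witnessing equality at [x] involve only finitely many edges, so they also witness it at
    nearby paths. *)
Lemma germ_locally_constant s t x z : germ s x = Some z -> germ t x = Some z ->
  exists N, forall y, mkseq y N = mkseq x N -> exists2 w, germ s y = Some w & germ t y = Some w.
Proof.
move=> sz tz; have xs : sdom s x by apply/germ_dom; exists z.
have xt : sdom t x by apply/germ_dom; exists z.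
have /(eq_germP xs xt) : germ s x = germ t x by rewrite sz.
case: s t {sz tz} xs xt => [s|//] [t|//] xs xt [N [sN tN eL ek]].
(* One edge more than the jets need: when [N] is 0, it is the first edge that forces equal
   ranges. *)
exists N.+1 => y yx.
have y0 : irg y = irg x by rewrite /irg; case: yx => ->.
have yN M : M <= N -> mkseq y M = mkseq x M.
  move=> MN; apply: (@eq_from_nth _ (x 0)); rewrite !size_mkseq // => i iM.
  have iN : i < N.+1 by rewrite (leq_trans iM) // ltnW.
  by move: (congr1 (fun p => nth (x 0) p i) yx); rewrite !nth_mkseq.
have ycyl a : plen a <= N -> cyl a x -> cyl a y.
  by move=> aN; rewrite !cylP y0 yN.
have ys := ycyl _ sN xs; have yt := ycyl _ tN xt.
have [w sw] : exists w, germ (Some s) y = Some w by apply/germ_dom.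
exists w => //; rewrite -sw; apply: eq_germ; first by split=> _.
move=> _ _.
by exists N; split=> //; rewrite /jetL /jetk /jetp yN.
Qed.

End Germs.

(** * Topology: the sets [Theta s] are open and compact *)

Lemma ultra_finite (X : Type) (I : choiceType) (F : set_system X) (f : X -> I) (D : set I) :
  UltraFilter F -> finite_set D -> F (f @^-1` D) -> exists i, F (f @^-1` [set i]).
Proof.
move=> FU /finite_seqP[l ->]; elim: l => [|i l IHl] h.
  by have /filter_ex[] := h.
have [Fi|Fni] := in_ultra_setVsetC (f @^-1` [set i]) FU; first by exists i.
apply: IHl; apply: filterS2 h Fni => z /=; rewrite inE => /orP[/eqP -> []|] //.
Qed.

Section Topology.
Context (T : selfSimilarTriple).
Notation G := (ssG T).
Notation E := (ssE T).
Implicit Types (x y : ipath E) (s t u : sge T) (a b c : Defs.fpath E) (z : Gtight T).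
Local Open Scope nat_scope.

Lemma open_Theta s : open (Theta s).
Proof.
exists [set Theta s]; last by rewrite bigcup_set1.
move=> _ ->; exists [fset (Theta s)]%fset.
  by move=> A; rewrite in_fset1 => /eqP ->; apply/mem_set; exists s.
apply/seteqP; split=> z /=.
  by apply=> /=; rewrite inE.
by move=> sz A /=; rewrite inE => /eqP ->.
Qed.

(** The sets [Theta s] form a subbase of the topology, so convergence need only be tested on
    them. *)
Lemma cvg_Gtight (F : set_system (Gtight T)) z : Filter F ->
  (forall s, Theta s z -> F (Theta s)) -> F --> z.
Proof.
move=> FF Fz A; rewrite nbhsE => -[B [[D' D'fin BE] Bz] BA].
apply: filterS BA _; rewrite -BE in Bz *; case: Bz => C D'C Cz.
apply: (@filterS _ _ _ C); first by move=> w Cw; exists C.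
have [D DT CE] := D'fin _ D'C; rewrite -CE in Cz *.
apply: filter_bigI => U UD; move: (set_mem (DT _ UD)) (Cz U UD) => -[t _ <-].
exact: Fz.
Qed.

(** Given an ultrafilter on [Theta s], each position of the source path has finitely many possible
    edges, so the ultrafilter selects one. The selected edges form a path [x], and the germ of [s]
    at [x] is a limit. *)
Lemma Theta_compact s : compact (Theta s).
Proof.
rewrite compact_ultra => F FU Fs.
case: s Fs => [s|] Fs; last by have /filter_ex[z [x]] := Fs.
(* Row-finiteness, iterated: each edge enters the source of the preceding one. *)
have fin n : exists2 X : set (edge E), finite_set X &
    forall z, Theta (Some s) z -> X (gsrc z n).
  elim: n => [|n [X Xfin XP]].
    exists [set e | rg e = prg (tb s)]; first exact: ss_row_finite.
    move=> z /ThetaE sz; have : sdom (Some s) (gsrc z) by apply/germ_dom; exists z.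
    by move=> /cylP[].
  exists (\bigcup_(e in X) [set e' | rg e' = sr e]).
    by apply: bigcup_finite => // e _; exact: ss_row_finite.
  by move=> z /XP Xz; exists (gsrc z n) => //=; rewrite -ipathP.
have ex n : exists e, F [set z | gsrc z n = e].
  have [X Xfin XP] := fin n.
  by apply: (@ultra_finite _ _ _ (fun z => gsrc z n) X) => //; apply: filterS Fs.
have [f fP] := choice ex.
have fpathf n : sr (f n) = rg (f n.+1).
  by have [z [<- <-]] := filter_ex (filterI (fP n) (fP n.+1)); exact: ipathP.
pose x := IPath fpathf.
have xF n : F [set z | mkseq (gsrc z) n = mkseq x n].
  elim: n => [|n IHn]; first by apply: filterS filterT.
  by apply: filterS2 IHn (fP n) => z /= h1 h2; rewrite !mkseqSc h1 h2.
(* The domain is a condition on finitely many edges, hence inherited from a germ that agrees with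
   [x] on them. Edge 0 is added to fix the range when [tb s] has length 0. *)
have xs : sdom (Some s) x.
  have [z [sz [zx z0]]] := filter_ex (filterI Fs (filterI (xF (plen (tb s))) (fP 0))).
  have : sdom (Some s) (gsrc z) by move/ThetaE: sz => sz; apply/germ_dom; exists z.
  move=> /cylP[h1 h2]; apply/cylP; rewrite -zx; split=> //.
  by rewrite -h1 /irg z0.
have /germ_dom[z sz] := xs.
exists z; split; first by exists x.
(* If [t] has the same germ as [s] at [x], it does so near [x], and the ultrafilter lives on germs
   of [s] with source near [x]. *)
apply: cvg_Gtight => t /ThetaE; rewrite (germ_src sz) => tz.
have [N NP] := germ_locally_constant sz tz.
apply: filterS2 Fs (xF N) => w /ThetaE sw /NP[w' sw' tw'].
by apply/ThetaE; rewrite tw' -sw' sw.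
Qed.

End Topology.

(** * Convolution of functions with finite source fibers *)

Section Convolution.
Context (T : selfSimilarTriple) (R : comStarRingType).
Implicit Types (s t u : sge T) (z : Gtight T) (f g h : Gtight T -> R).

(* [conv] is a finitary sum, with junk value 0 on infinite supports; finite source
   fibers make the supports finite, which bilinearity needs. *)
Definition fin_fibers f :=
  forall x, finite_set [set z | gsrc z = x /\ f z != 0].

Lemma gmul_src z1 z2 z : gmul z1 z2 = Some z -> gsrc z1 = grng z2 /\ gsrc z2 = gsrc z.
Proof.
rewrite /gmul; case: eqP => // e sz; split=> //.
by rewrite (germ_src sz).
Qed.

(** In a factorization of [z], the right factor has the source of [z], and the left factor has the
    range of the right one as its source. Both thus run over finite fibers. *)
Lemma conv_supp f g z : fin_fibers f -> fin_fibers g ->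
  exists2 D : set (Gtight T * Gtight T), finite_set D &
    forall zz, gmul zz.1 zz.2 = Some z -> ~ D zz -> f zz.1 = 0 \/ g zz.2 = 0.
Proof.
move=> ff fg; pose D2 := [set w | gsrc w = gsrc z /\ g w != 0].
pose D1 := \bigcup_(w in D2) [set w' | gsrc w' = grng w /\ f w' != 0].
exists (D1 `*` D2); first (apply: finite_setX; last exact: fg).
  by apply: bigcup_finite => [|w _]; [exact: fg|exact: ff].
move=> [z1 z2] /= /gmul_src[e1 e2] nD.
have [->|f0] := eqVneq (f z1) 0; first by left.
have [->|g0] := eqVneq (g z2) 0; first by right.
by case: nD; split=> //=; exists z2.
Qed.

(** The finite set may exceed the support, so several convolutions can be expanded over a common
    index set. *)
Lemma conv_big f g z (D : set (Gtight T * Gtight T)) : finite_set D ->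
  (forall zz, gmul zz.1 zz.2 = Some z -> ~ D zz -> f zz.1 = 0 \/ g zz.2 = 0) ->
  conv f g z = \sum_(zz <- fset_set D)
    (if gmul zz.1 zz.2 == Some z then f zz.1 * g zz.2 else 0).
Proof.
move=> Dfin DP; rewrite /conv fsbig_mkcond -fsbig_finite //.
rewrite (fsbig_widen D setT) => [|//|zz [_ nD]] /=.
  apply: eq_fsbigr => zz _; rewrite /patch; congr (if _ then _ else _).
  by apply/idP/eqP => [/set_mem|h]; last exact/mem_set.
by case: eqP => // /DP[] // ->; rewrite ?mul0r ?mulr0.
Qed.

Lemma convDl f f' g : fin_fibers f -> fin_fibers f' -> fin_fibers g ->
  conv (fun z => f z + f' z) g = (fun z => conv f g z + conv f' g z).
Proof.
move=> ff ff' fg; apply/funext => z.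
have [D Dfin DP] := conv_supp z ff fg; have [D' Dfin' DP'] := conv_supp z ff' fg.
have Ufin : finite_set (D `|` D') by rewrite finite_setU.
rewrite !(conv_big Ufin) -?big_split /=.
- by apply: eq_bigr => zz _; case: ifP => _; rewrite ?mulrDl ?addr0.
- by move=> zz /DP' h nU; apply: h => ?; apply: nU; right.
- by move=> zz /DP h nU; apply: h => ?; apply: nU; left.
move=> zz e nU; have [|->|->] := DP zz e; [by move=> ?; apply: nU; left| |by right].
have [|->|->] := DP' zz e; [by move=> ?; apply: nU; right| |by right].
by left; rewrite addr0.
Qed.

Lemma convDr f g g' : fin_fibers f -> fin_fibers g -> fin_fibers g' ->
  conv f (fun z => g z + g' z) = (fun z => conv f g z + conv f g' z).
Proof.
move=> ff fg fg'; apply/funext => z.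
have [D Dfin DP] := conv_supp z ff fg; have [D' Dfin' DP'] := conv_supp z ff fg'.
have Ufin : finite_set (D `|` D') by rewrite finite_setU.
rewrite !(conv_big Ufin) -?big_split /=.
- by apply: eq_bigr => zz _; case: ifP => _; rewrite ?mulrDr ?addr0.
- by move=> zz /DP' h nU; apply: h => ?; apply: nU; right.
- by move=> zz /DP h nU; apply: h => ?; apply: nU; left.
move=> zz e nU; have [|->|->] := DP zz e; [by move=> ?; apply: nU; left|by left|].
have [|->|->] := DP' zz e; [by move=> ?; apply: nU; right|by left|].
by right; rewrite addr0.
Qed.

Lemma convZl r f g : fin_fibers f -> fin_fibers g ->
  conv (fun z => r * f z) g = (fun z => r * conv f g z).
Proof.
move=> ff fg; apply/funext => z; have [D Dfin DP] := conv_supp z ff fg.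
rewrite !(conv_big Dfin) // ?big_distrr /=.
  by apply: eq_bigr => zz _; case: ifP => _; rewrite ?mulr0 ?mulrA.
by move=> zz e /(DP _ e)[] ->; [left; rewrite mulr0|right].
Qed.

Lemma convZr r f g : fin_fibers f -> fin_fibers g ->
  conv f (fun z => r * g z) = (fun z => r * conv f g z).
Proof.
move=> ff fg; apply/funext => z; have [D Dfin DP] := conv_supp z ff fg.
rewrite !(conv_big Dfin) // ?big_distrr /=.
  by apply: eq_bigr => zz _; case: ifP => _; rewrite ?mulr0 // mulrCA.
by move=> zz e /(DP _ e)[] ->; [left|right; rewrite mulr0].
Qed.

Lemma conv0l g : conv (fun=> 0) g = (fun=> 0).
Proof. by apply/funext => z; rewrite /conv fsbig1 // => zz _; rewrite mul0r. Qed.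

Lemma conv0r f : conv f (fun=> 0) = (fun=> 0).
Proof. by apply/funext => z; rewrite /conv fsbig1 // => zz _; rewrite mulr0. Qed.

(** Only one factorization of [z] can contribute: the germ of [t] at the source of [z], and the germ
    of [s] at the image point. *)
Lemma conv_Theta s t : conv \1_(Theta s) \1_(Theta t) = \1_(Theta (smul s t)) :> (Gtight T -> R).
Proof.
apply/funext => z; rewrite indicE; case: (boolP (z \in _)).
  move=> /set_mem/ThetaE stz.
  have /sdom_smul[xt xs] : sdom (smul s t) (gsrc z) by apply/germ_dom; exists z.
  have [z2 tz2] : exists z2, germ t (gsrc z) = Some z2 by apply/germ_dom.
  have [z1 sz1] : exists z1, germ s (sact t (gsrc z)) = Some z1 by apply/germ_dom.
  have [z' m] := gmulE sz1 tz2; rewrite stz => -[zz']; subst z'.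
  have in1 : Theta s z1 by exists (sact t (gsrc z)).
  have in2 : Theta t z2 by exists (gsrc z).
  rewrite /conv -(fsbig_widen [set (z1, z2)]) ?fsbig_set1 /=.
  - by rewrite !indicE !mem_set // mulr1.
  - by move=> _ ->.
  move=> [w1 w2] /= [/gmul_src[e1 e2] ne]; rewrite !indicE.
  case: (boolP (w1 \in _)) => [|_]; last by rewrite mul0r.
  move=> /set_mem/ThetaE h1; case: (boolP (w2 \in _)) => [|_]; last by rewrite mulr0.
  move=> /set_mem/ThetaE h2; case: ne; rewrite e2 tz2 in h2.
  case: h2 => h2; subst w2; rewrite e1 (germ_rng tz2) sz1 in h1.
  by case: h1 => ->.
rewrite notin_setE => nz; rewrite /conv fsbig1 // => -[z1 z2] /= m.
rewrite !indicE; case: (boolP (z1 \in _)) => [|_]; last by rewrite mul0r.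
case: (boolP (z2 \in _)) => [|_]; last by rewrite mulr0.
move=> /set_mem/ThetaE h2 /set_mem/ThetaE h1; case: nz.
have [e1 e2] := gmul_src m; rewrite e1 (germ_rng h2) in h1.
have [z' m' h] := gmulE h1 h2; move: m' h; rewrite m => -[<-] h.
by exists (gsrc z2).
Qed.

(** * The span of the indicators as a star algebra *)

Definition theta_sum (l : seq (R * sge T)) : Gtight T -> R :=
  fun z => \sum_(p <- l) p.1 * \1_(Theta p.2) z.

Definition theta_span f := exists l, f = theta_sum l.

Lemma theta_sum0 : theta_sum [::] = (fun=> 0).
Proof. by apply/funext => z; rewrite /theta_sum big_nil. Qed.

Lemma theta_sum_cons p l :
  theta_sum (p :: l) = (fun z => p.1 * \1_(Theta p.2) z + theta_sum l z).
Proof. by apply/funext => z; rewrite /theta_sum big_cons. Qed.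

Lemma theta_span0 : theta_span (fun=> 0).
Proof. by exists [::]; rewrite theta_sum0. Qed.

Lemma theta_spanD f g : theta_span f -> theta_span g -> theta_span (fun z => f z + g z).
Proof.
by move=> [l ->] [m ->]; exists (l ++ m); apply/funext => z; rewrite /theta_sum big_cat.
Qed.

Lemma theta_spanZ r f : theta_span f -> theta_span (fun z => r * f z).
Proof.
move=> [l ->]; exists [seq (r * p.1, p.2) | p <- l]; apply/funext => z.
by rewrite /theta_sum big_map big_distrr /=; apply: eq_bigr => p _; rewrite mulrA.
Qed.

Lemma theta_span1 s : theta_span \1_(Theta s).
Proof.
by exists [:: (1, s)]; apply/funext => z; rewrite /theta_sum big_cons big_nil mul1r addr0.
Qed.

Lemma theta_span_ind (P : (Gtight T -> R) -> Prop) :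
  P (fun=> 0) ->
  (forall r s f, theta_span f -> P f -> P (fun z => r * \1_(Theta s) z + f z)) ->
  forall f, theta_span f -> P f.
Proof.
move=> P0 PS f [l ->]; elim: l => [|p l IHl]; first by rewrite theta_sum0.
by rewrite theta_sum_cons; apply: PS => //; exists l.
Qed.

(** Each indicator adds at most one germ to the fiber over [x], namely the germ of [s] at [x]. *)
Lemma fin_fibers_span f : theta_span f -> fin_fibers f.
Proof.
move: f; apply: theta_span_ind => [x|r s f _ ff x].
  by apply: (@sub_finite_set _ _ set0) => // z /= []; rewrite eqxx.
apply: (@sub_finite_set _ _ ([set z | germ s x = Some z] `|` [set z | gsrc z = x /\ f z != 0])).
  move=> z /= [zx]; have [fz|fz _] := eqVneq (f z) 0; last by right.
  rewrite fz addr0 indicE; case: (boolP (z \in _)) => [|_]; last by rewrite mulr0 eqxx.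
  by move=> /set_mem/ThetaE; rewrite zx; left.
rewrite finite_setU; split=> //; case: (germ s x) => [z|].
  by apply: (@sub_finite_set _ _ [set z]) => // w [->].
by apply: (@sub_finite_set _ _ set0).
Qed.

Lemma theta_span_conv f g : theta_span f -> theta_span g -> theta_span (conv f g).
Proof.
move=> + gS; have fg := fin_fibers_span gS; move: f; apply: theta_span_ind => [|r s f fS IH].
  by rewrite conv0l; exact: theta_span0.
have f1 := fin_fibers_span (theta_span1 s).
rewrite convDl ?convZl //; [|exact/fin_fibers_span/theta_spanZ/theta_span1|exact: fin_fibers_span].
apply: theta_spanD => //; apply: theta_spanZ.
move: g gS {IH} fg; apply: theta_span_ind => [|r' t g gS IH] _.
  by rewrite conv0r; exact: theta_span0.
have fg := fin_fibers_span gS.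
have f1' := fin_fibers_span (theta_span1 t).
rewrite convDr ?convZr ?conv_Theta //; last exact/fin_fibers_span/theta_spanZ/theta_span1.
by apply: theta_spanD => //; [apply: theta_spanZ; exact: theta_span1|exact: IH].
Qed.

Lemma conv_starD f g :
  conv_star (fun z => f z + g z) = (fun z => conv_star f z + conv_star g z).
Proof. by apply/funext => z; rewrite /conv_star conjrD. Qed.

Lemma conv_starZ r f : conv_star (fun z => r * f z) = (fun z => conjr r * conv_star f z).
Proof. by apply/funext => z; rewrite /conv_star conjrM. Qed.

Lemma conjr0 : conjr 0 = 0 :> R.
Proof. by apply: (addrI (conjr 0)); rewrite -conjrD !addr0. Qed.

Lemma conv_starK : involutive (@conv_star T R).
Proof. by move=> f; apply/funext => z; rewrite /conv_star ginvK conjrK. Qed.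

Lemma conv_star_Theta s : conv_star \1_(Theta s) = \1_(Theta (sstar s)) :> (Gtight T -> R).
Proof.
apply/funext => z; rewrite /conv_star !indicE.
have -> : (ginv z \in Theta s) = (z \in Theta (sstar s)).
  by apply/idP/idP => /set_mem/Theta_ginv/mem_set.
by case: (_ \in _); rewrite ?conjr1 ?conjr0.
Qed.

Lemma conv_star0 : conv_star (fun=> 0) = (fun=> 0) :> (Gtight T -> R).
Proof. by apply/funext => z; rewrite /conv_star conjr0. Qed.

Lemma theta_span_star f : theta_span f -> theta_span (conv_star f).
Proof.
move: f; apply: theta_span_ind => [|r s f _ IH].
  by rewrite conv_star0; exact: theta_span0.
rewrite conv_starD conv_starZ conv_star_Theta; apply: theta_spanD => //.
exact/theta_spanZ/theta_span1.
Qed.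

(* Only a subspace of [steinberg R], but one containing the image of the
   homomorphism to be constructed. *)
Record stein := Stein { stein_fun :> Gtight T -> R; stein_funP : theta_span stein_fun }.
HB.instance Definition _ := gen_eqMixin stein.
HB.instance Definition _ := gen_choiceMixin stein.
Implicit Types (F H K : stein).

Lemma stein_inj F H : stein_fun F = stein_fun H -> F = H.
Proof.
case: F H => [f fS] [h hS] /= fh; subst h.
by congr Stein; exact: Prop_irrelevance.
Qed.

Let stein_fib F : fin_fibers F. Proof. exact/fin_fibers_span/stein_funP. Qed.

Definition stein_theta s := Stein (theta_span1 s).

Let szero := Stein theta_span0.
Let sadd F H := Stein (theta_spanD (stein_funP F) (stein_funP H)).
Let sscale r F := Stein (theta_spanZ r (stein_funP F)).
Let sopp F := sscale (-1) F.
Let smulf F H := Stein (theta_span_conv (stein_funP F) (stein_funP H)).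
Let sstarf F := Stein (theta_span_star (stein_funP F)).

Let saddA : associative sadd.
Proof. by move=> F H K; apply/stein_inj/funext => z /=; rewrite addrA. Qed.
Let saddC : commutative sadd.
Proof. by move=> F H; apply/stein_inj/funext => z /=; rewrite addrC. Qed.
Let sadd0 : left_id szero sadd.
Proof. by move=> F; apply/stein_inj/funext => z /=; rewrite add0r. Qed.
Let saddN : left_inverse szero sopp sadd.
Proof. by move=> F; apply/stein_inj/funext => z /=; rewrite mulN1r addNr. Qed.
HB.instance Definition _ := GRing.isZmodule.Build stein saddA saddC sadd0 saddN.

Let sscaleA r r' F : sscale r (sscale r' F) = sscale (r * r') F.
Proof. by apply/stein_inj/funext => z /=; rewrite mulrA. Qed.
Let sscale1 : left_id 1 sscale.
Proof. by move=> F; apply/stein_inj/funext => z /=; rewrite mul1r. Qed.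
Let sscaleDr : right_distributive sscale +%R.
Proof. by move=> r F H; apply/stein_inj/funext => z /=; rewrite mulrDr. Qed.
Let sscaleDl F : {morph sscale^~ F : r r' / r + r'}.
Proof. by move=> r r'; apply/stein_inj/funext => z /=; rewrite mulrDl. Qed.
HB.instance Definition _ :=
  GRing.Zmodule_isLmodule.Build R stein sscaleA sscale1 sscaleDr sscaleDl.

(** Reduces identities that are additive in each argument to the indicators. *)
Lemma stein_theta_ind (P : stein -> Prop) :
  P 0 -> (forall r s F, P F -> P (r *: stein_theta s + F)) -> forall F, P F.
Proof.
move=> P0 PS [f fS]; have [l fl] := fS; elim: l => [|p l IHl] in f fS fl *.
  by rewrite (_ : Stein fS = 0) //; apply: stein_inj; rewrite /= fl theta_sum0.
have lS : theta_span (theta_sum l) by exists l.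
rewrite (_ : Stein fS = p.1 *: stein_theta p.2 + Stein lS).
  by apply: PS; exact: IHl.
by apply: stein_inj; rewrite /= fl theta_sum_cons.
Qed.

Let smulDl : left_distributive smulf +%R.
Proof. by move=> F H K; apply: stein_inj; exact: convDl. Qed.
Let smulDr : right_distributive smulf +%R.
Proof. by move=> F H K; apply: stein_inj; exact: convDr. Qed.
Let smulZl r F H : smulf (r *: F) H = r *: smulf F H.
Proof. by apply: stein_inj; exact: convZl. Qed.
Let smulZr r F H : smulf F (r *: H) = r *: smulf F H.
Proof. by apply: stein_inj; exact: convZr. Qed.
Let smul0f F : smulf 0 F = 0.
Proof. by apply: stein_inj; exact: conv0l. Qed.
Let smulf0 F : smulf F 0 = 0.
Proof. by apply: stein_inj; exact: conv0r. Qed.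
Let smul_theta s t : smulf (stein_theta s) (stein_theta t) = stein_theta (smul s t).
Proof. by apply: stein_inj; exact: conv_Theta. Qed.

(** Trilinearity reduces to three indicators; there it suffices that the two bracketings have the
    same germs, since [Theta] depends on germs only. *)
Let smulfA : associative smulf.
Proof.
elim/stein_theta_ind => [H K|r s F IH H K]; first by rewrite !smul0f.
rewrite !smulDl -IH !smulZl; congr (_ *: _ + _).
elim/stein_theta_ind: H K => [K|r' t H IHH K]; first by rewrite !(smulf0, smul0f).
rewrite smulDl !smulDr smulDl IHH !(smulZl, smulZr); congr (_ *: _ + _).
elim/stein_theta_ind: K => [|r'' u K IHK]; first by rewrite !smulf0.
rewrite !smulDr !smulZr IHK !smul_theta; congr (_ *: _ + _).
by apply: stein_inj; rewrite /= (eq_Theta (germ_smulA s t u)).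
Qed.

Let sstarfP (r : R) F H : sstarf (r *: F + H) = conjr r *: sstarf F + sstarf H.
Proof. by apply: stein_inj; rewrite /= conv_starD conv_starZ. Qed.
Let sstarf0 : sstarf 0 = 0.
Proof. by apply: stein_inj; exact: conv_star0. Qed.
Let sstarfK : involutive sstarf.
Proof. by move=> F; apply: stein_inj; exact: conv_starK. Qed.
Let sstar_theta s : sstarf (stein_theta s) = stein_theta (sstar s).
Proof. by apply: stein_inj; exact: conv_star_Theta. Qed.

Let sstarfM F H : sstarf (smulf F H) = smulf (sstarf H) (sstarf F).
Proof.
elim/stein_theta_ind: F => [|r s F IH]; first by rewrite smul0f sstarf0 smulf0.
rewrite smulDl smulZl !sstarfP IH smulDr smulZr; congr (_ *: _ + _).
elim/stein_theta_ind: H {IH} => [|r' t H IH]; first by rewrite smulf0 sstarf0 smul0f.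
rewrite smulDr smulZr !sstarfP IH smulDl smulZl; congr (_ *: _ + _).
rewrite smul_theta !sstar_theta smul_theta.
by apply: stein_inj; rewrite /= (eq_Theta (germ_sstar_smul s t)).
Qed.

HB.instance Definition _ := isStarAlg.Build R stein
  smulfA smulDl smulDr smulZl smulZr sstarfK sstarfM sstarfP.

Local Open Scope starAlg_scope.

Lemma stein_thetaM s t : stein_theta s ** stein_theta t = stein_theta (smul s t).
Proof. exact: smul_theta. Qed.

Lemma star_stein_theta s : star (stein_theta s) = stein_theta (sstar s).
Proof. exact: sstar_theta. Qed.

Lemma stein_theta0 : stein_theta None = 0.
Proof.
apply/stein_inj/funext => z; rewrite /= indicE memNset // => -[x] //.
Qed.

Lemma steinberg_stein F : steinberg F.
Proof.
have [l ->] := stein_funP F; exists (size l), (fun i => (tnth (in_tuple l) i).1),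
  (fun i => Theta (tnth (in_tuple l) i).2); split=> [i|].
  by split; [exact: Theta_compact|exact: open_Theta|exact: Theta_bisection].
by apply/funext => z; rewrite /theta_sum big_tnth.
Qed.

Lemma steinberg_hom_stein (A : starAlgType R) (k : A -> stein) :
  star_hom k -> steinberg_hom (fun a => stein_fun (k a)).
Proof.
case=> lin mul st; split=> [a|r a b z|a b|a]; first exact: steinberg_stein.
- by rewrite lin.
- by rewrite mul.
- by rewrite st.
Qed.

End Convolution.

(** * The triples of the generators and their relations *)

Section Family.
Context (T : selfSimilarTriple).
Notation G := (ssG T).
Notation E := (ssE T).
Local Notation "g *v v" := (actv (ss_act T) g v) (at level 35, right associativity).
Local Notation "g *e e" := (acte (ss_act T) g e) (at level 35, right associativity).
Implicit Types (x y : ipath E) (s t u : sge T) (a b c d : Defs.fpath E) (z : Gtight T)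
  (g h f : G) (v w : vert E) (e : edge E).

Lemma fcat_vpathl v c : prg c = v -> fcat (vpath v) c = c.
Proof. by move=> <-; apply: fpath_inj; rewrite ?prg_fcat ?pedges_fcat. Qed.

Lemma fcat_vpathr a v : psr a = v -> fcat a (vpath v) = a.
Proof. by move=> <-; apply: fpath_inj; rewrite ?prg_fcat ?pedges_fcat ?cats0. Qed.

Lemma pact_vpath g v : pact g (vpath v) = vpath (g *v v).
Proof. exact: fpath_inj. Qed.

Lemma pact_epath g e : pact g (epath e) = epath (g *e e).
Proof. by apply: fpath_inj => //; rewrite -[RHS]/(rg _) act_rg. Qed.

Lemma fprefix_vpath v c : fprefix (vpath v) c = (v == prg c).
Proof. by rewrite /fprefix /= prefix0s andbT. Qed.

Lemma fprefix_epath_vpath e v : fprefix (epath e) (vpath v) = false.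
Proof. by rewrite /fprefix /= andbF. Qed.

Lemma fprefix_epath e e' : fprefix (epath e) (epath e') = (e == e').
Proof.
rewrite /fprefix /= andbT.
by case: (eqVneq e e') => [->|]; rewrite ?eqxx ?andbF.
Qed.

(** The first branch of the product with the remainder [c] made explicit; every nonzero product of
    generator triples computed below is brought to this form. *)
Lemma smul_sgeT a g b c h d :
  psr a = g *v psr b -> psr b = prg c -> psr c = h *v psr d ->
  smul (sgeT a g b) (sgeT (fcat b c) h d) =
    sgeT (fcat a (pact g c)) (coc g (pedges c) * h)%g d.
Proof.
move=> ab bc cd; have [s [-> s1 s2 s3]] := sgeTE ab.
have [|t [-> t1 t2 t3]] := @sgeTE T (fcat b c) h d; first by rewrite psr_fcat.
rewrite /smul s1 s2 s3 t1 t2 t3 ifT; last by apply/fprefixP; exists c.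
suff -> : fdrop (plen b) (fcat b c) = c by [].
apply: fpath_inj.
  by rewrite prg_fdrop prg_fcat // pedges_fcat // take_size_cat.
by rewrite pedges_fdrop pedges_fcat // drop_size_cat.
Qed.

Lemma smul_sgeT0 a g b c h d :
  ~~ fprefix b c -> ~~ fprefix c b -> smul (sgeT a g b) (sgeT c h d) = None.
Proof.
move=> /negPf bc /negPf cb.
have [/sgeTE[s [-> s1 s2 s3]]|ne] := eqVneq (psr a) (g *v psr b); last first.
  by rewrite {1}/sgeT insubN.
have [/sgeTE[t [-> t1 t2 t3]]|ne] := eqVneq (psr c) (h *v psr d); last first.
  by rewrite /sgeT insubN.
by rewrite /smul s3 t1 bc cb.
Qed.

Lemma sstar_sgeT a g b : psr a = g *v psr b -> sstar (sgeT a g b) = sgeT b g^-1%g a.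
Proof.
by move=> /sgeTE[t [-> <- <- <-]]; rewrite -[sstar _]/(Some (tinv t)) -sgeT_val.
Qed.

Lemma actvK g v : g^-1%g *v g *v v = v.
Proof. by rewrite -actvM mulVg actv1. Qed.

Lemma actvVK g v : g *v g^-1%g *v v = v.
Proof. by rewrite -actvM mulgV actv1. Qed.

Definition sgeP v f : sge T := sgeT (vpath v) f (vpath (f^-1%g *v v)).
Definition sgeS e g : sge T := sgeT (epath e) g (vpath (g^-1%g *v sr e)).

Lemma sstar_sgeP v f : sstar (sgeP v f) = sgeP (f^-1%g *v v) f^-1%g.
Proof. by rewrite /sgeP sstar_sgeT ?actvVK ?invgK ?actvVK // [RHS]actvVK. Qed.

Lemma sgePP v f w h :
  smul (sgeP v f) (sgeP w h) = if v == f *v w then sgeP v (f * h)%g else None.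
Proof.
case: eqP => [->|ne]; last first.
  apply: smul_sgeT0; rewrite fprefix_vpath; apply/eqP => /= e; apply: ne.
    by rewrite -[w]e actvVK.
  by rewrite [w]e; exact/esym/actvVK.
(* A vertex is written as itself followed by an empty remainder, to match [smul_sgeT]. *)
rewrite /sgeP actvK -[in X in smul _ X](@fcat_vpathl w (vpath w)) // smul_sgeT //; last first.
  exact: sgeT_vpath.
by rewrite pact_vpath fcat_vpathl // invgM actvM actvK.
Qed.

Lemma sgePS v f e g :
  smul (sgeP v f) (sgeS e g) =
    if v == rg (f *e e) then sgeS (f *e e) (phi f e * g)%g else None.
Proof.
rewrite act_rg; case: eqP => [->|ne]; last first.
  apply: smul_sgeT0; rewrite ?fprefix_epath_vpath // fprefix_vpath; apply/eqP => /= e'.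
  by apply: ne; rewrite -[rg e]e' actvVK.
rewrite /sgeP /sgeS actvK -[in X in smul _ X](@fcat_vpathl (rg e) (epath e)) //.
rewrite smul_sgeT //; last exact: sgeT_vpath.
rewrite pact_epath fcat_vpathl; last exact: act_rg.
by rewrite act_sr -(phi_actv f e) invgM actvM actvK.
Qed.

Lemma sgeSP e g v f :
  smul (sgeS e g) (sgeP v f) = if g *v v == sr e then sgeS e (g * f)%g else None.
Proof.
case: eqP => [gv|ne]; last first.
  apply: smul_sgeT0; rewrite fprefix_vpath; apply/eqP => /= e'; apply: ne.
    by rewrite -[v]e' actvVK.
  by rewrite [v]e'; exact: actvVK.
rewrite /sgeS /sgeP -gv actvK -[in X in smul _ X](@fcat_vpathl v (vpath v)) //.
rewrite smul_sgeT //; last exact: sgeT_vpath.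
by rewrite pact_vpath fcat_vpathr // invgM actvM actvK.
Qed.

Lemma sgeSS e e' :
  smul (sstar (sgeS e 1%g)) (sgeS e' 1%g) = if e == e' then sgeP (sr e) 1%g else None.
Proof.
rewrite /sgeS sstar_sgeT; last exact: sgeT_epath.
case: eqP => [<-|ne]; last first.
  by apply: smul_sgeT0; rewrite fprefix_epath; apply/eqP => // /esym.
rewrite -[in X in smul _ X](@fcat_vpathr (epath e) (sr e)) //.
rewrite smul_sgeT ?invg1 //=; try by rewrite !actv1.
by rewrite pact_vpath !actv1 fcat_vpathl // mulg1 /sgeP invg1 actv1.
Qed.

Lemma sgeSSstar e : smul (sgeS e 1%g) (sstar (sgeS e 1%g)) = sidem (epath e).
Proof.
rewrite /sgeS sstar_sgeT; last exact: sgeT_epath.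
rewrite invg1 actv1 -[in X in smul _ X](@fcat_vpathl (sr e) (vpath (sr e))) //.
rewrite smul_sgeT ?actv1 //.
by rewrite pact_vpath actv1 fcat_vpathr // mulg1.
Qed.

Lemma sdom_sidem c x : sdom (sidem c) x <-> cyl c x.
Proof.
have [|t [tE _ _ tb]] := @sgeTE T c 1%g c; first by rewrite actv1.
by rewrite /sidem tE /= tb.
Qed.

(** At level [plen c + plen d] both jets consist of the initial segment of [x] and the unit of the
    group. *)
Lemma germ_sidem c d x : cyl c x -> cyl d x -> germ (sidem c) x = germ (sidem d) x.
Proof.
move=> xc xd; apply/eq_germP; rewrite ?sdom_sidem //.
have [|s [sE s1 s2 s3]] := @sgeTE T c 1%g c; first by rewrite actv1.
have [|t [tE t1 t2 t3]] := @sgeTE T d 1%g d; first by rewrite actv1.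
rewrite /sidem sE tE /=; exists (plen c + plen d)%N.
have sc : (plen (tb s) <= plen c + plen d)%N by rewrite s3 leq_addr.
have td : (plen (tb t) <= plen c + plen d)%N by rewrite t3 leq_addl.
split=> //; rewrite /jetL /jetk s2 t2 ?coc1 //.
have cs : cyl (tb s) x by rewrite s3.
have ct : cyl (tb t) x by rewrite t3.
have := cyl_jetp ct td; have := cyl_jetp cs sc.
by rewrite !eact1 s1 t1 s3 t3 => <- <-.
Qed.

(** The edge is the first one of the source path of [z]; [germ_sidem] passes between the two
    idempotents. *)
Lemma Theta_sgeP1 v z : Theta (sgeP v 1%g) z <->
  exists2 e, rg e = v & Theta (sidem (epath e)) z.
Proof.
have -> : sgeP v 1%g = sidem (vpath v) by rewrite /sgeP invg1 actv1.
have vcyl x : cyl (vpath v) x <-> irg x = v by rewrite cylP; split=> [[]|].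
have ecyl e x : cyl (epath e) x <-> x 0%N = e.
  by rewrite cylP; split=> [[_ [->]]|<-].
split=> [[x xz]|[e ev [x xz]]].
  have /vcyl xv : cyl (vpath v) x by apply/sdom_sidem/germ_dom; exists z.
  by exists (x 0%N) => //; exists x; rewrite -xz; apply: germ_sidem; [apply/ecyl|apply/vcyl].
have xe : x 0%N = e by apply/ecyl/sdom_sidem/germ_dom; exists z.
exists x; rewrite -xz; apply: germ_sidem; [apply/vcyl|exact/ecyl].
by rewrite /irg xe.
Qed.

(** Makes the union in [Theta_sgeP1] disjoint. *)
Lemma Theta_sidem_epath e z : Theta (sidem (epath e)) z -> gsrc z 0%N = e.
Proof.
move=> /ThetaE ez; have : cyl (epath e) (gsrc z) by apply/sdom_sidem/germ_dom; exists z.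
by move=> /cylP[_ [->]].
Qed.

(** Without sources, an edge into each vertex can be chosen and the choice iterated. *)
Lemma ex_ipath v : exists x : ipath E, irg x = v.
Proof.
have [nx nxP] := choice (@ss_no_sources T).
pose w n := iter n (fun w => sr (nx w)) v.
have wP n : sr (nx (w n)) = rg (nx (w n.+1)) by rewrite nxP.
by exists (IPath wP); rewrite /irg /= nxP.
Qed.

Lemma Theta_nonempty a g v : psr a = g *v v -> Theta (sgeT a g (vpath v)) !=set0.
Proof.
move=> av; have [t [-> _ _ tb]] := @sgeTE T a g (vpath v) av.
have [x xv] := ex_ipath v.
have /germ_dom[z tz] : sdom (Some t) x by rewrite /= tb; apply/cylP.
by exists z, x.
Qed.

(** * The family of indicators and uniqueness of the homomorphism *)

Section Representation.
Context (R : comStarRingType).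
Local Open Scope starAlg_scope.

Let P v f : stein T R := stein_theta R (sgeP v f).
Let S e g : stein T R := stein_theta R (sgeS e g).

Lemma stein_sum (I : Type) (l : seq I) (F : I -> stein T R) z :
  (\sum_(i <- l) F i) z = \sum_(i <- l) F i z.
Proof. by elim: l => [|i l IHl]; rewrite ?big_nil // !big_cons -IHl. Qed.

Lemma GE_family_theta : is_GE_family P S.
Proof.
have PP v f w h : P v f ** P w h = if v == f *v w then P v (f * h)%g else 0.
  by rewrite stein_thetaM sgePP; case: eqP; rewrite // stein_theta0.
have SP e g v f : S e g ** P v f = if g *v v == sr e then S e (g * f)%g else 0.
  by rewrite stein_thetaM sgeSP; case: eqP; rewrite // stein_theta0.
have SS e e' : star (S e 1%g) ** S e' 1%g = if e == e' then P (sr e) 1%g else 0.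
  by rewrite star_stein_theta stein_thetaM sgeSS; case: eqP; rewrite // stein_theta0.
have sP v f : star (P v f) = P (f^-1%g *v v) f^-1%g.
  by rewrite star_stein_theta sstar_sgeP.
split=> //; last first.
- by move=> v f e g; rewrite stein_thetaM sgePS; case: eqP; rewrite // stein_theta0.
split=> // [v|v w /negPf vw|e|v].
- by split; rewrite ?sP ?PP ?invg1 ?actv1 ?eqxx ?mulg1.
- by rewrite PP actv1 vw.
- by rewrite /partial_isometry -amulA SS eqxx SP actv1 eqxx mulg1.
have [l ul lP] := edges_into v; rewrite (edges_sum _ ul lP).
apply/stein_inj/funext => z; rewrite stein_sum.
under eq_bigr => e _ do rewrite star_stein_theta stein_thetaM sgeSSstar /=.
(* Exactly one summand is 1 at a germ of the vertex idempotent, the one for the first edge of its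
   source; elsewhere all vanish. *)
rewrite /P /= indicE; case: (boolP (z \in _)) => [/set_mem/Theta_sgeP1[e ev ez]|nz].
  rewrite (bigD1_seq e) ?lP ?ev //= big1_seq ?addr0 => [|e' /andP[e'e _]].
    by rewrite indicE mem_set.
  rewrite indicE memNset // => /Theta_sidem_epath e'z.
  by move: e'e; rewrite -e'z (Theta_sidem_epath ez) eqxx.
rewrite big1_seq // => e /=; rewrite lP => /eqP ev.
rewrite indicE memNset // => ez; move/negP: nz; apply; apply/mem_set/Theta_sgeP1.
by exists e.
Qed.

(** The uniqueness in [LGE_universal] concerns maps into a star algebra, while here the values are
    bare functions that are not known to lie in [stein]. Hence the induction on terms representing
    elements of [LGE]. *)
Lemma steinberg_hom_unique (k k' : LGE T R -> Gtight T -> R) :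
  steinberg_hom k -> steinberg_hom k' ->
  (forall v f, k (Lp R v f) = k' (Lp R v f)) ->
  (forall e g, k (Ls R e g) = k' (Ls R e g)) -> k = k'.
Proof.
move=> kH kH' kp ks.
have h0 (j : LGE T R -> Gtight T -> R) : steinberg_hom j -> j 0 = (fun=> 0).
  (* The scalar -1 makes the right-hand side cancel. *)
  move=> [_ lin _ _]; apply/funext => z; have := lin (-1) 0 0 z.
  by rewrite scaler0 addr0 mulN1r addNr.
have hZ (j : LGE T R -> Gtight T -> R) r (a : LGE T R) :
  steinberg_hom j -> j (r *: a) = (fun z => r * j a z).
  by move=> jH; apply/funext => z; rewrite -[r *: a]addr0 (steinberg_hom_linear jH) h0 // addr0.
have hD (j : LGE T R -> Gtight T -> R) (a b : LGE T R) :
  steinberg_hom j -> j (a + b) = (fun z => j a z + j b z).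
  by move=> jH; apply/funext => z; rewrite -[a]scale1r (steinberg_hom_linear jH) scale1r mul1r.
apply/funext => a; rewrite -[a]prepK.
elim: (prep a) => [x||t IHt t' IHt'|t IHt|r t IHt|t IHt t' IHt'|t IHt].
- by case: x => [v f|e g]; [exact: kp|exact: ks].
- by rewrite pcl0 !h0.
- by rewrite pclD !hD // IHt IHt'.
- by rewrite pclN -scaleN1r !hZ // IHt.
- by rewrite pclZ !hZ // IHt.
- by rewrite pclM (steinberg_hom_mul kH) (steinberg_hom_mul kH') IHt IHt'.
- by rewrite pcl_star (steinberg_hom_star kH) (steinberg_hom_star kH') IHt.
Qed.

End Representation.
End Family.

Unset Implicit Arguments.
Set Strict Implicit.

Theorem proposition3p7 (R : comStarRingType) (T : selfSimilarTriple) :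
  (exists! pi : LGE T R -> (Gtight T -> R),
     [/\ steinberg_hom pi,
         forall (v : vert (ssE T)) (f : ssG T),
           pi (Lp R v f) =
             \1_(Theta (sgeT (vpath v) f (vpath (actv (ss_act T) f^-1%g v))))
       & forall (e : edge (ssE T)) (g : ssG T),
           pi (Ls R e g) =
             \1_(Theta (sgeT (epath e) g (vpath (actv (ss_act T) g^-1%g (sr e)))))])
  /\ (forall (v : vert (ssE T)) (f : ssG T), Lp R v f <> 0)
  /\ (forall (e : edge (ssE T)) (g : ssG T), Ls R e g <> 0).
Proof.
have [k [[khom kp ks] _]] := LGE_universal (GE_family_theta T R).
have k0 : k 0 = 0.
  by have := star_hom_linear khom (-1) 0 0; rewrite scaler0 addr0 scaleN1r addNr.
(* Evaluation at a germ in [Theta s] gives 1, which differs from 0 in [R]. *)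
have nonzero s : Theta s !=set0 -> stein_theta R s <> 0 :> stein T R.
  move=> [z sz] /(congr1 (fun F : stein T R => F z)).
  by rewrite /= indicE mem_set // => /eqP; rewrite oner_eq0.
split; last first.
  split=> [v f|e g] /(congr1 k); rewrite k0 ?kp ?ks; apply: nonzero.
    by apply: Theta_nonempty; exact: sgeT_vpath.
  by apply: Theta_nonempty; exact: sgeT_epath.
exists (fun a => stein_fun (k a)); split.
  split=> [|v f|e g]; [exact: steinberg_hom_stein|by rewrite kp|by rewrite ks].
move=> k' [kH' kp' ks']; apply: steinberg_hom_unique => //.
- exact: steinberg_hom_stein.
- by move=> v f; rewrite kp kp'.
- by move=> e g; rewrite ks ks'.
Qed.
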